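(* Synchronizability is undecidable: there is no algorithm that, given a message set $M$ and an $M$-system $S$, decides whether $S$ is synchronizable. Likewise, language synchronizability is undecidable.
   Context: A message set $M=(\Sigma_M,n,\mathrm{src},\mathrm{dst})$ consists of a finite set $\Sigma_M$ of messages, a number $n\ge 1$ of peers, and maps $\mathrm{src},\mathrm{dst}:\Sigma_M\to\{1,\dots,n\}$ with $\mathrm{src}(a)\neq\mathrm{dst}(a)$. Actions are $!a$ (send, by peer $\mathrm{src}(a)$) and $?a$ (receive, by peer $\mathrm{dst}(a)$). An $M$-trace is a finite sequence of actions; $!?a$ abbreviates $!a\cdot ?a$. For a trace $\tau$, $\pi_!(\tau)$ is the sequence of messages sent in $\tau$; for channel $i\to j$, $\mathrm{buf}_{i\to j}(\tau)$ is the word $w$ (if it exists) such that (messages sent on $i\to j$) $=$ (messages received on $i\to j$)$\cdot w$. $\tau$ is FIFO (resp. $k$-bounded FIFO) if for all $i,j$ and prefixes $\tau'$, $\mathrm{buf}_{i\to j}(\tau')$ is defined (resp. defined and of length $\le k$); synchronous if $\tau=!?a_1\cdots!?a_k$. An $M$-system $S=(P_1,\dots,P_n)$ consists of finite automata $P_i$ (all states accepting) over the actions of peer $i$, communicating through one FIFO channel per ordered pair $(i,j)$, $i\ne j$ (peer-to-peer communication). A configuration gives a control state per peer and the content $w_{i,j}$ of each channel; it is stable if all channels are empty. $!a$ with $\mathrm{src}(a)=i,\mathrm{dst}(a)=j$ moves $P_i$ and appends $a$ to $w_{i,j}$; $?a$ moves $P_j$ and removes $a$ from the head of $w_{i,j}$.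 $c_0$ is the initial configuration (initial states, empty channels). $T_k(S)$ ($k\ge1$) is the set of $k$-bounded FIFO traces $\tau$ with $c_0\xrightarrow{\tau}c$ for some $c$; $T_0(S)$ the synchronous such traces; $T_\omega(S)=\bigcup_k T_k(S)$. $ST^w_k(S)=\{\pi_!(\tau)\mid\tau\in T_k(S)\}$ and $ST_k(S)=ST^w_k(S)\cup\{(\pi_!(\tau),c)\mid c_0\xrightarrow{\tau}c,\ c\text{ stable},\ \tau\in T_k(S)\}$. $S$ is synchronizable if $ST_0(S)=ST_\omega(S)$ and language synchronizable if $ST^w_0(S)=ST^w_\omega(S)$. *)

(* Defs.v *)
From HB Require Import structures.
From mathcomp Require Import all_boot.

Set Implicit Arguments.
Unset Strict Implicit.
Unset Printing Implicit Defensive.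

(* Message sets.  M = (n, l): peers are 0 .. n-1 (the paper's 1..n), the    *)
(* messages are 0 .. size l - 1, and message a has (src a, dst a) = nth a l. *)
Definition msgset := (nat * seq (nat * nat))%type.

Definition npeers (M : msgset) : nat := M.1.
Definition nmsgs (M : msgset) : nat := size M.2.
Definition src (M : msgset) (a : nat) : nat := (nth (0, 0) M.2 a).1.
Definition dst (M : msgset) (a : nat) : nat := (nth (0, 0) M.2 a).2.

Definition wf_msgset (M : msgset) : Prop :=
  1 <= npeers M /\
  forall a, a < nmsgs M ->
    [/\ src M a < npeers M, dst M a < npeers M & src M a != dst M a].

Inductive action := Send of nat | Recv of nat.

Definition act_code (x : action) : bool * nat :=
  match x with Send a => (true, a) | Recv a => (false, a) end.
Definition act_decode (p : bool * nat) : action :=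
  if p.1 then Send p.2 else Recv p.2.
Lemma act_codeK : cancel act_code act_decode. Proof. by case. Qed.
HB.instance Definition _ := Countable.copy action (can_type act_codeK).

Definition msg_of (x : action) : nat := match x with Send a | Recv a => a end.
Definition peer_of (M : msgset) (x : action) : nat :=
  match x with Send a => src M a | Recv a => dst M a end.

(* Systems.  Peer i is a finite automaton (all states accepting) given by an *)
(* initial state and a finite list of transitions (q, action, q').  Its set   *)
(* of states is thus finite (the states occurring in it).                    *)
Definition automaton := (nat * seq (nat * action * nat))%type.
Definition system := seq automaton.

Definition init_of (S : system) (i : nat) : nat := (nth (0, [::]) S i).1.
Definition trans (S : system) (i : nat) : seq (nat * action * nat) :=
  (nth (0, [::]) S i).2.

Definition wf_system (M : msgset) (S : system) : Prop :=
  size S = npeers M /\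
  forall i, i < size S -> forall t, t \in trans S i ->
    msg_of t.1.2 < nmsgs M /\ peer_of M t.1.2 = i.

Definition wf_input (x : msgset * system) : Prop :=
  wf_msgset x.1 /\ wf_system x.1 x.2.

(* Configurations: control state of each peer, and content of each channel *)
(* i -> j (FIFO, head of the queue = head of the list).                      *)
Record config := Config { cstate : seq nat; cchan : nat -> nat -> seq nat }.

Definition c0 (S : system) : config :=
  Config (map fst S) (fun _ _ => [::]).

Definition stable (c : config) : Prop := forall i j, cchan c i j = [::].

Definition upd (ch : nat -> nat -> seq nat) (i j : nat) (w : seq nat) :=
  fun i' j' => if (i' == i) && (j' == j) then w else ch i' j'.

Inductive step (M : msgset) (S : system) : config -> action -> config -> Prop :=
| step_send a st ch q' :
    a < nmsgs M ->
    (nth 0 st (src M a), Send a, q') \in trans S (src M a) ->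
    step M S (Config st ch) (Send a)
      (Config (set_nth 0 st (src M a) q')
              (upd ch (src M a) (dst M a) (rcons (ch (src M a) (dst M a)) a)))
| step_recv a st ch w q' :
    a < nmsgs M ->
    ch (src M a) (dst M a) = a :: w ->
    (nth 0 st (dst M a), Recv a, q') \in trans S (dst M a) ->
    step M S (Config st ch) (Recv a)
      (Config (set_nth 0 st (dst M a) q') (upd ch (src M a) (dst M a) w)).

Inductive reach (M : msgset) (S : system) : config -> seq action -> config -> Prop :=
| reach_nil c : reach M S c [::] c
| reach_cons c x c' t c'' :
    step M S c x c' -> reach M S c' t c'' -> reach M S c (x :: t) c''.

Definition sends (t : seq action) : seq nat :=
  pmap (fun x => if x is Send a then Some a else None) t.
Definition recvs (t : seq action) : seq nat :=
  pmap (fun x => if x is Recv a then Some a else None) t.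

Definition on_chan (M : msgset) (i j : nat) (s : seq nat) : seq nat :=
  [seq a <- s | (src M a == i) && (dst M a == j)].

(* buf_{i->j}(t) is defined iff the received word is a prefix of the sent
   word; its length is then the difference of the lengths. *)
Definition kFIFO (M : msgset) (k : nat) (t : seq action) : Prop :=
  forall p i j,
    let snt := on_chan M i j (sends (take p t)) in
    let rcv := on_chan M i j (recvs (take p t)) in
    prefix rcv snt /\ size snt - size rcv <= k.

Definition synchronous (t : seq action) : Prop :=
  exists s : seq nat, t = flatten [seq [:: Send a; Recv a] | a <- s].

Definition inT (M : msgset) (S : system) (k : nat) (t : seq action) : Prop :=
  (if k == 0 then synchronous t else kFIFO M k t) /\
  exists c, reach M S (c0 S) t c.

Definition inTomega (M : msgset) (S : system) (t : seq action) : Prop :=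
  exists k, 0 < k /\ inT M S k t.

Definition STw_of (T : seq action -> Prop) (w : seq nat) : Prop :=
  exists t, T t /\ sends t = w.

(* ST for a set of traces T: words, plus pairs (word, stable configuration).
   A stable configuration has all channels empty, so it is represented by
   its vector of control states. *)
Definition ST_of (M : msgset) (S : system) (T : seq action -> Prop)
  (x : seq nat + (seq nat * seq nat)) : Prop :=
  match x with
  | inl w => STw_of T w
  | inr (w, q) => exists t c, [/\ T t, reach M S (c0 S) t c, stable c,
                                  sends t = w & cstate c = q]
  end.

Definition synchronizable (M : msgset) (S : system) : Prop :=
  forall x, ST_of M S (inT M S 0) x <-> ST_of M S (inTomega M S) x.

Definition lang_synchronizable (M : msgset) (S : system) : Prop :=
  forall w, STw_of (inT M S 0) w <-> STw_of (inTomega M S) w.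

Inductive instr := INC of nat | DEC of nat & nat.
Definition program := seq instr.

Definition mstate := (nat * (nat -> nat))%type.

Definition mstep (P : program) (s : mstate) : mstate :=
  let: (pc, regs) := s in
  if pc < size P then
    match nth (INC 0) P pc with
    | INC r => (pc.+1, fun r' => if r' == r then (regs r).+1 else regs r')
    | DEC r j => if regs r == 0 then (j, regs)
                 else (pc.+1, fun r' => if r' == r then (regs r).-1 else regs r')
    end
  else s.

Definition halts_with (P : program) (n m : nat) : Prop :=
  exists steps, let: (pc, regs) := iter steps (mstep P) (0, fun r => if r == 0 then n else 0)
                in size P <= pc /\ regs 0 = m.

Definition decides (A : countType) (valid Q : A -> Prop) (P : program) : Prop :=
  forall x, valid x ->
    (Q x -> halts_with P (pickle x) 1) /\ (~ Q x -> halts_with P (pickle x) 0).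

Definition undecidable (A : countType) (valid Q : A -> Prop) : Prop :=
  ~ exists P : program, decides valid Q P.

(* Main.v *)
Require Import Defs.
From mathcomp Require Import all_boot.
From mathcomp Require Import zify.
From Stdlib Require Import FunctionalExtensionality.

(** The halting problem of counter machines is reduced to (non-)synchronizability
    by a three-peer system.  Peer 0 walks through a finite graph and emits two
    words u and v letter by letter: u directly to peer 1, v through the relay
    peer 2, which acknowledges every letter, so that peers 0 and 2 run in lock
    step.  Peer 1 checks that u follows v, and sends a message when it meets an
    end mark in u after a prefix common to u and v.  Every word v is written
    ahead of u, hence in a synchronous run peer 1 hears from the relay first and
    falls into a state where it receives everything and sends nothing; an
    asynchronous run may delay these receptions, but changes the sent words only
    if the check succeeds.  The graph lets v = C_0 # C_1 # ... and
    u = C_0' # C_1' # ..., where C_(i+1) is a successor of C_i' for the machine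
    being simulated; the check forces C_i' = C_i, so it succeeds exactly when the
    machine halts.

    A machine P deciding either property could be turned into a machine E that,
    on input x, encodes the system simulating E on x, runs P on it and halts
    iff the answer is positive.  As x ranges over codes of lists of
    transitions, the self reference needs no universal machine: x is the code of
    the transitions of peer 0 that depend only on E, and the encoding just
    prepends the x pairs of transitions that write the input x. *)

Set Implicit Arguments.
Unset Strict Implicit.
Unset Printing Implicit Defensive.

(** * Traces *)

Lemma reach_cat M S c t c' t' c'' :
  reach M S c t c' -> reach M S c' t' c'' -> reach M S c (t ++ t') c''.
Proof. by elim=> // c1 x c2 s c3 st _ IH /IH; apply: reach_cons. Qed.

Lemma reach_catP M S c t t' c'' : reach M S c (t ++ t') c'' ->
  exists2 c', reach M S c t c' & reach M S c' t' c''.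
Proof.
elim: t c => [|x t IH] c /= r; first by exists c => //; apply: reach_nil.
inversion_clear r as [|? ? c1 ? ? st r1].
by have [c' r2 r3] := IH _ r1; exists c' => //; apply: reach_cons st r2.
Qed.

Lemma reach1 M S c x c' : step M S c x c' -> reach M S c [:: x] c'.
Proof. by move=> st; apply: reach_cons st (reach_nil _ _ _). Qed.

Lemma reach_rcons M S c t c' x c'' :
  reach M S c t c' -> step M S c' x c'' -> reach M S c (rcons t x) c''.
Proof. by rewrite -cats1 => r /reach1; apply: reach_cat. Qed.

Lemma reach_rconsP M S c t x c'' : reach M S c (rcons t x) c'' ->
  exists2 c', reach M S c t c' & step M S c' x c''.
Proof.
rewrite -cats1 => /reach_catP[c' r r1]; exists c' => //.
inversion_clear r1 as [|? ? c1 ? ? st r2].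
by inversion r2; subst.
Qed.

(** Conservation law of FIFO channels. From the empty initial channels it makes every executable
    trace FIFO, each channel holding exactly its unread suffix. *)
Lemma reach_buffers M S c t c' : reach M S c t c' -> forall i j,
  on_chan M i j (recvs t) ++ cchan c' i j = cchan c i j ++ on_chan M i j (sends t).
Proof.
elim=> {c t c'} [c i j|c x c' t c'' st _ IH i j]; first by rewrite cats0.
case: st IH => [a st ch q' _ _|a st ch w q' _ ew _] /(_ i j) /=;
  rewrite /on_chan /= /upd ![_ == i]eq_sym ![_ == j]eq_sym.
- by case: eqVneq => [->|_] //=; case: eqVneq => [->|_] //=; rewrite -cats1 -catA.
- by case: eqVneq => [->|_] //=; case: eqVneq => [->|_] //= ->; rewrite ew.
Qed.

(** A channel never holds more messages than the trace has actions. The successor keeps the bound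
    positive, since bound 0 stands for synchronous traces. *)
Lemma reach_kFIFO M S t c : reach M S (c0 S) t c -> kFIFO M (size t).+1 t.
Proof.
move=> r p i j /=; have := r; rewrite -{1}(cat_take_drop p t).
case/reach_catP => c' /reach_buffers/(_ i j) /= eqb _.
split; first by rewrite -eqb prefix_prefix.
have le_sends s : size (sends s) <= size s by rewrite size_pmap count_size.
apply: leq_trans (leq_subr _ _) _; rewrite size_filter.
apply: leq_trans (count_size _ _) _; apply: leq_trans (le_sends _) _.
by rewrite size_take_min; apply/leqW/geq_minr.
Qed.

Lemma reach_inTomega M S t c : reach M S (c0 S) t c -> inTomega M S t.
Proof.
move=> r; exists (size t).+1; split=> //; split; last by exists c.
exact: reach_kFIFO r.
Qed.

Lemma sends_cat s t : sends (s ++ t) = sends s ++ sends t.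
Proof. exact: pmap_cat. Qed.

Definition sync_trace (w : seq nat) : seq action :=
  flatten [seq [:: Send a; Recv a] | a <- w].

Lemma sync_trace_rcons w a :
  sync_trace (rcons w a) = rcons (rcons (sync_trace w) (Send a)) (Recv a).
Proof. by rewrite /sync_trace map_rcons flatten_rcons -!cats1 -catA. Qed.

Lemma sends_sync_trace w : sends (sync_trace w) = w.
Proof. by elim: w => //= a w ->. Qed.

Lemma inT0_sync M S w : inT M S 0 (sync_trace w) <->
  exists c, reach M S (c0 S) (sync_trace w) c.
Proof. by split=> [[]|r] //; split=> //; exists w. Qed.

(** * The three-peer system of a graph *)

(* (q, (b, a), q') emits a on u if b holds, on v otherwise. *)
Definition edge := (nat * (bool * nat) * nat)%type.

Inductive gpath (G : seq edge) (q0 : nat) : nat -> seq nat -> seq nat -> Prop :=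
| gpath_nil : gpath G q0 q0 [::] [::]
| gpath_u q u v a q' :
    gpath G q0 q u v -> (q, (true, a), q') \in G -> gpath G q0 q' (rcons u a) v
| gpath_v q u v a q' :
    gpath G q0 q u v -> (q, (false, a), q') \in G -> gpath G q0 q' u (rcons v a).

(** After the two fixed messages, the residue modulo 3 determines the channel, so [channel_of] does
    not depend on the size of the alphabet. *)
Definition ackm := 0.
Definition goalm := 1.
Definition umsg a := 3 * a + 2.
Definition vmsg a := 3 * a + 3.
Definition rmsg a := 3 * a + 4.

Definition channel_of (k : nat) : nat * nat :=
  match k with
  | 0 => (2, 0)
  | 1 => (1, 0)
  | k'.+2 => match k' %% 3 with 0 => (0, 1) | 1 => (0, 2) | _ => (2, 1) end
  end.

Definition queue_msgset (A : nat) : msgset := (3, mkseq channel_of (3 * A + 2)).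

(* Graph node q is state 2q; in state 2q + 1 the peer waits for the relay before
   entering q. *)
Definition generator_edge (e : edge) : seq (nat * action * nat) :=
  let: (q, (b, a), q') := e in
  if b then [:: (q.*2, Send (umsg a), q'.*2)]
  else [:: (q.*2, Send (vmsg a), q'.*2.+1); (q'.*2.+1, Recv ackm, q'.*2)].

Definition generator (q0 : nat) (G : seq edge) : automaton :=
  (q0.*2, flatten (map generator_edge G)).

(* States of the checker: in 0 the words read so far agree, in a + 3 the word u
   is one letter a ahead, in 2 the end mark was read, and 1 is the trash state. *)
Definition checker_letter (a : nat) : seq (nat * action * nat) :=
  [:: (0, Recv (umsg a), a.+3); (a.+3, Recv (rmsg a), 0);
      (0, Recv (rmsg a), 1); (1, Recv (umsg a), 1); (1, Recv (rmsg a), 1)].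

Definition checker (A : nat) : automaton :=
  (0, (0, Recv (umsg 0), 2) :: (2, Send goalm, 1)
        :: flatten [seq checker_letter a | a <- iota 0 A]).

Definition relay_letter (a : nat) : seq (nat * action * nat) :=
  [:: (0, Recv (vmsg a), a.+2); (a.+2, Send (rmsg a), 1)].

Definition relay (A : nat) : automaton :=
  (0, (1, Send ackm, 0) :: flatten [seq relay_letter a | a <- iota 0 A]).

Definition queue_system (A q0 : nat) (G : seq edge) : system :=
  [:: generator q0 G; checker A; relay A].

Lemma umsg_inj : injective umsg. Proof. by move=> a b; rewrite /umsg; lia. Qed.
Lemma vmsg_inj : injective vmsg. Proof. by move=> a b; rewrite /vmsg; lia. Qed.
Lemma rmsg_inj : injective rmsg. Proof. by move=> a b; rewrite /rmsg; lia. Qed.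

Lemma channel_umsg a : channel_of (umsg a) = (0, 1).
Proof. by rewrite /umsg addn2 /= modnMr. Qed.
Lemma channel_vmsg a : channel_of (vmsg a) = (0, 2).
Proof. by rewrite /vmsg addn3 /= -addn1 mulnC modnMDl. Qed.
Lemma channel_rmsg a : channel_of (rmsg a) = (2, 1).
Proof. by rewrite /rmsg addn4 /= -addn2 mulnC modnMDl. Qed.

Lemma nmsgs_queue A : nmsgs (queue_msgset A) = 3 * A + 2.
Proof. exact: size_mkseq. Qed.

Lemma msg_channel A k : k < 3 * A + 2 ->
  (src (queue_msgset A) k, dst (queue_msgset A) k) = channel_of k.
Proof. by move=> lt_k; rewrite /src /dst nth_mkseq //; case: channel_of. Qed.

Local Arguments trans : simpl never.

Section QueueSystem.

Variables (A q0 : nat) (G : seq edge).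
Hypothesis A_gt0 : 0 < A.
Hypothesis letterG : forall e, e \in G -> e.1.2.2 < A.

Let M := queue_msgset A.
Let S := queue_system A q0 G.

(** * Endpoints and bounds of the messages *)

Lemma src_umsg a : a < A -> src M (umsg a) = 0.
Proof.
move=> lt_a; have /msg_channel : umsg a < 3 * A + 2 by rewrite /umsg; lia.
by rewrite channel_umsg => -[].
Qed.
Lemma dst_umsg a : a < A -> dst M (umsg a) = 1.
Proof.
move=> lt_a; have /msg_channel : umsg a < 3 * A + 2 by rewrite /umsg; lia.
by rewrite channel_umsg => -[].
Qed.
Lemma src_vmsg a : a < A -> src M (vmsg a) = 0.
Proof.
move=> lt_a; have /msg_channel : vmsg a < 3 * A + 2 by rewrite /vmsg; lia.
by rewrite channel_vmsg => -[].
Qed.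
Lemma dst_vmsg a : a < A -> dst M (vmsg a) = 2.
Proof.
move=> lt_a; have /msg_channel : vmsg a < 3 * A + 2 by rewrite /vmsg; lia.
by rewrite channel_vmsg => -[].
Qed.
Lemma src_rmsg a : a < A -> src M (rmsg a) = 2.
Proof.
move=> lt_a; have /msg_channel : rmsg a < 3 * A + 2 by rewrite /rmsg; lia.
by rewrite channel_rmsg => -[].
Qed.
Lemma dst_rmsg a : a < A -> dst M (rmsg a) = 1.
Proof.
move=> lt_a; have /msg_channel : rmsg a < 3 * A + 2 by rewrite /rmsg; lia.
by rewrite channel_rmsg => -[].
Qed.
Lemma src_ackm : src M ackm = 2. Proof. by rewrite /src nth_mkseq // addn2. Qed.
Lemma dst_ackm : dst M ackm = 0. Proof. by rewrite /dst nth_mkseq // addn2. Qed.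
Lemma src_goalm : src M goalm = 1. Proof. by rewrite /src nth_mkseq // addn2. Qed.
Lemma dst_goalm : dst M goalm = 0. Proof. by rewrite /dst nth_mkseq // addn2. Qed.

Definition ends := (src_umsg, dst_umsg, src_vmsg, dst_vmsg, src_rmsg, dst_rmsg,
                    src_ackm, dst_ackm, src_goalm, dst_goalm).

Lemma lt_umsg a : a < A -> umsg a < nmsgs M.
Proof. by rewrite nmsgs_queue /umsg; lia. Qed.
Lemma lt_vmsg a : a < A -> vmsg a < nmsgs M.
Proof. by rewrite nmsgs_queue /vmsg; lia. Qed.
Lemma lt_rmsg a : a < A -> rmsg a < nmsgs M.
Proof. by rewrite nmsgs_queue /rmsg; lia. Qed.
Lemma lt_ackm : ackm < nmsgs M. Proof. by rewrite nmsgs_queue addn2. Qed.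
Lemma lt_goalm : goalm < nmsgs M. Proof. by rewrite nmsgs_queue addn2. Qed.

(** * Transitions of the three peers in inductive form *)

Inductive generator_trans : nat * action * nat -> Prop :=
| GenU q a q' : (q, (true, a), q') \in G ->
    generator_trans (q.*2, Send (umsg a), q'.*2)
| GenV q a q' : (q, (false, a), q') \in G ->
    generator_trans (q.*2, Send (vmsg a), q'.*2.+1)
| GenAck q a q' : (q, (false, a), q') \in G ->
    generator_trans (q'.*2.+1, Recv ackm, q'.*2).

Inductive checker_trans : nat * action * nat -> Prop :=
| ChkEnd : checker_trans (0, Recv (umsg 0), 2)
| ChkGoal : checker_trans (2, Send goalm, 1)
| ChkU a : a < A -> checker_trans (0, Recv (umsg a), a.+3)
| ChkR a : a < A -> checker_trans (a.+3, Recv (rmsg a), 0)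
| ChkTrash a : a < A -> checker_trans (0, Recv (rmsg a), 1)
| ChkTrashU a : a < A -> checker_trans (1, Recv (umsg a), 1)
| ChkTrashR a : a < A -> checker_trans (1, Recv (rmsg a), 1).

Inductive relay_trans : nat * action * nat -> Prop :=
| RelAck : relay_trans (1, Send ackm, 0)
| RelV a : a < A -> relay_trans (0, Recv (vmsg a), a.+2)
| RelR a : a < A -> relay_trans (a.+2, Send (rmsg a), 1).

Lemma generator_transP t : t \in trans S 0 <-> generator_trans t.
Proof.
rewrite /trans /=; split=> [/flattenP[s /mapP[[[q [[] a]] q'] eG ->]]|].
- by rewrite inE => /eqP ->; constructor.
- by rewrite !inE => /orP[] /eqP ->; [constructor | apply: GenAck eG].
case=> q a q' eG; apply/flattenP;
  (eexists; [apply: map_f eG | by rewrite !inE eqxx ?orbT]).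
Qed.

Lemma checker_transP t : t \in trans S 1 <-> checker_trans t.
Proof.
rewrite /trans /= !inE; split.
  case/or3P=> [/eqP->|/eqP->|/flattenP[s /mapP[a]]]; [by constructor..|].
  rewrite mem_iota add0n => /= lt_a ->; rewrite !inE.
  by case/or4P => [/eqP->|/eqP->|/eqP->|/orP[]/eqP->]; constructor.
have in_letter a s : a < A -> s \in checker_letter a ->
  s \in flatten [seq checker_letter a | a <- iota 0 A].
  by move=> lt_a s_a; apply/flattenP; exists (checker_letter a); rewrite ?map_f ?mem_iota.
case=> [||a lt_a|a lt_a|a lt_a|a lt_a|a lt_a]; rewrite ?eqxx ?orbT //;
by rewrite (in_letter a) ?orbT // !inE eqxx ?orbT.
Qed.

Lemma relay_transP t : t \in trans S 2 <-> relay_trans t.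
Proof.
rewrite /trans /= !inE; split.
  case/orP=> [/eqP->|/flattenP[s /mapP[a]]]; first by constructor.
  rewrite mem_iota add0n => /= lt_a ->; rewrite !inE.
  by case/orP => /eqP->; constructor.
case=> [|a lt_a|a lt_a]; rewrite ?eqxx //; apply/orP; right;
by apply/flattenP; exists (relay_letter a); rewrite ?map_f ?mem_iota // !inE eqxx ?orbT.
Qed.

Lemma queue_wf : wf_input (M, S).
Proof.
split; split=> //=.
  move=> k; rewrite nmsgs_queue => /msg_channel.
  case: k => [|[|k]] /=; try by case=> -> ->.
  by case: (k %% 3) => [|[|?]] [-> ->].
case=> [|[|[|//]]] _ t.
- case/generator_transP=> q a q' /letterG lt_a /=;
  by rewrite ?ends ?lt_umsg ?lt_vmsg ?lt_ackm.
- case/checker_transP=> [||a lt_a|a lt_a|a lt_a|a lt_a|a lt_a] /=;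
  by rewrite ?ends ?lt_umsg ?lt_rmsg ?lt_goalm.
- case/relay_transP=> [|a lt_a|a lt_a] /=;
  by rewrite ?ends ?lt_vmsg ?lt_rmsg ?lt_ackm.
Qed.

(** * Configurations with explicit queues and their moves *)

Definition chans (cu cv cr : seq nat) (ca cm : nat) : nat -> nat -> seq nat :=
  fun i j => match i, j with
  | 0, 1 => map umsg cu
  | 0, 2 => map vmsg cv
  | 2, 1 => map rmsg cr
  | 2, 0 => nseq ca ackm
  | 1, 0 => nseq cm goalm
  | _, _ => [::]
  end.

Definition cfg p0 p1 p2 cu cv cr ca cm :=
  Config [:: p0; p1; p2] (chans cu cv cr ca cm).

Lemma upd_chans cu cv cr ca cm :
  [/\ forall w, upd (chans cu cv cr ca cm) 0 1 (map umsg w) = chans w cv cr ca cm,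
      forall w, upd (chans cu cv cr ca cm) 0 2 (map vmsg w) = chans cu w cr ca cm,
      forall w, upd (chans cu cv cr ca cm) 2 1 (map rmsg w) = chans cu cv w ca cm,
      forall k, upd (chans cu cv cr ca cm) 2 0 (nseq k ackm) = chans cu cv cr k cm
    & forall k, upd (chans cu cv cr ca cm) 1 0 (nseq k goalm) = chans cu cv cr ca k].
Proof.
split=> w; do 2![apply: functional_extensionality => -[|[|[|?]]]] => //;
by apply: functional_extensionality => -[|[|[|?]]].
Qed.

Inductive move p0 p1 p2 cu cv cr ca cm : action -> config -> Prop :=
| MvU q a q' : p0 = q.*2 -> (q, (true, a), q') \in G ->
    move p0 p1 p2 cu cv cr ca cm
      (Send (umsg a)) (cfg q'.*2 p1 p2 (rcons cu a) cv cr ca cm)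
| MvV q a q' : p0 = q.*2 -> (q, (false, a), q') \in G ->
    move p0 p1 p2 cu cv cr ca cm
      (Send (vmsg a)) (cfg q'.*2.+1 p1 p2 cu (rcons cv a) cr ca cm)
| MvRecvAck q a q' ca' : p0 = q'.*2.+1 -> (q, (false, a), q') \in G -> ca = ca'.+1 ->
    move p0 p1 p2 cu cv cr ca cm
      (Recv ackm) (cfg q'.*2 p1 p2 cu cv cr ca' cm)
| MvRecvU a cu' p1' : a < A -> cu = a :: cu' -> checker_trans (p1, Recv (umsg a), p1') ->
    move p0 p1 p2 cu cv cr ca cm
      (Recv (umsg a)) (cfg p0 p1' p2 cu' cv cr ca cm)
| MvRecvR a cr' p1' : a < A -> cr = a :: cr' -> checker_trans (p1, Recv (rmsg a), p1') ->
    move p0 p1 p2 cu cv cr ca cm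
      (Recv (rmsg a)) (cfg p0 p1' p2 cu cv cr' ca cm)
| MvGoal : p1 = 2 ->
    move p0 p1 p2 cu cv cr ca cm
      (Send goalm) (cfg p0 1 p2 cu cv cr ca cm.+1)
| MvRecvV a cv' : a < A -> cv = a :: cv' -> p2 = 0 ->
    move p0 p1 p2 cu cv cr ca cm
      (Recv (vmsg a)) (cfg p0 p1 a.+2 cu cv' cr ca cm)
| MvR a : a < A -> p2 = a.+2 ->
    move p0 p1 p2 cu cv cr ca cm
      (Send (rmsg a)) (cfg p0 p1 1 cu cv (rcons cr a) ca cm)
| MvAck : p2 = 1 ->
    move p0 p1 p2 cu cv cr ca cm
      (Send ackm) (cfg p0 p1 0 cu cv cr ca.+1 cm).

Lemma rcons_nseq n (x : nat) : rcons (nseq n x) x = nseq n.+1 x.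
Proof. by elim: n => //= n ->. Qed.

Lemma map_eq_cons (f : nat -> nat) a s w : injective f ->
  map f s = f a :: w -> exists2 s', s = a :: s' & w = map f s'.
Proof. by case: s => //= b s injf [/injf -> <-]; exists s. Qed.

Lemma step_move p0 p1 p2 cu cv cr ca cm x c :
  step M S (cfg p0 p1 p2 cu cv cr ca cm) x c <-> move p0 p1 p2 cu cv cr ca cm x c.
Proof.
have [updU updV updR updA updG] := upd_chans cu cv cr ca cm.
have sendP k q' : k < nmsgs M ->
    (nth 0 [:: p0; p1; p2] (src M k), Send k, q') \in trans S (src M k) ->
    [\/ src M k = 0 /\ generator_trans (p0, Send k, q'),
        src M k = 1 /\ checker_trans (p1, Send k, q') |
        src M k = 2 /\ relay_trans (p2, Send k, q')].
  rewrite nmsgs_queue => /msg_channel.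
  case: (src M k) => [|[|[|?]]].
  - by move=> _ /generator_transP; constructor 1.
  - by move=> _ /checker_transP; constructor 2.
  - by move=> _ /relay_transP; constructor 3.
  - by case: k => [|[|k]] //=; case: (k %% 3) => [|[|]].
have recvP k q' : k < nmsgs M ->
    (nth 0 [:: p0; p1; p2] (dst M k), Recv k, q') \in trans S (dst M k) ->
    [\/ dst M k = 0 /\ generator_trans (p0, Recv k, q'),
        dst M k = 1 /\ checker_trans (p1, Recv k, q') |
        dst M k = 2 /\ relay_trans (p2, Recv k, q')].
  rewrite nmsgs_queue => /msg_channel.
  case: (dst M k) => [|[|[|?]]].
  - by move=> _ /generator_transP; constructor 1.
  - by move=> _ /checker_transP; constructor 2.
  - by move=> _ /relay_transP; constructor 3.
  - by case: k => [|[|k]] //=; case: (k %% 3) => [|[|]].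
split.
  rewrite /cfg; move Ec: (Config _ _) => c1 st; case: st Ec => {x c c1}.
    move=> k st ch q' lt_k tr [est ech]; subst st ch.
    case: (sendP _ _ lt_k tr) => -[es]; rewrite es.
    - move Et: (p0, _, _) => t gt; case: gt Et => // [q a q1|q a q1] eG [e1 e2 e3]; subst k.
      + rewrite dst_umsg ?(letterG eG) //= -map_rcons updU e3.
        by apply: MvU eG.
      + rewrite dst_vmsg ?(letterG eG) //= -map_rcons updV e3.
        by apply: MvV eG.
    - move Et: (p1, _, _) => t gt; case: gt Et => // -[e1 e2 e3]; subst k.
      by rewrite dst_goalm /= rcons_nseq updG e3; apply: MvGoal.
    - move Et: (p2, _, _) => t gt; case: gt Et => [|//|a lt_a] [e1 e2 e3]; subst k.
      + by rewrite dst_ackm /= rcons_nseq updA e3; apply: MvAck.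
      + by rewrite dst_rmsg //= -map_rcons updR e3; apply: MvR.
  move=> k st ch w q' lt_k ew tr [est ech]; subst st ch.
  case: (recvP _ _ lt_k tr) => -[es]; rewrite es.
  - move Et: (p0, _, _) => t gt; case: gt Et => // q a q1 eG [e1 e2 e3]; subst k.
    move: ew; rewrite src_ackm dst_ackm /=.
    case: ca updA {recvP sendP updU updV updR updG} => //= ca updA [<-].
    by rewrite updA e3; apply: MvRecvAck eG _.
  - move=> gt; have : (exists2 a, a < A & k = umsg a) \/ (exists2 a, a < A & k = rmsg a).
      move: gt; move Et: (p1, _, _) => t gt.
      case: gt Et => // [|a lt_a|a lt_a|a lt_a|a lt_a|a lt_a] [_ -> _];
        by [left; exists 0 | left; exists a | right; exists a].
    case=> -[a lt_a ek]; subst k; move: ew.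
    + rewrite src_umsg ?dst_umsg //= => /(map_eq_cons umsg_inj)[cu' eu ->].
      by rewrite updU; apply: MvRecvU.
    + rewrite src_rmsg ?dst_rmsg //= => /(map_eq_cons rmsg_inj)[cr' er ->].
      by rewrite updR; apply: MvRecvR.
  - move Et: (p2, _, _) => t gt; case: gt Et => // a lt_a [e1 e2 e3]; subst k.
    move: ew; rewrite src_vmsg ?dst_vmsg //= => /(map_eq_cons vmsg_inj)[cv' ev ->].
    by rewrite updV e3; apply: MvRecvV.
case=> {sendP recvP}.
- move=> q a q' -> eG; have lt_a := letterG eG.
  have := @step_send M S (umsg a) [:: q.*2; p1; p2] (chans cu cv cr ca cm) q'.*2.
  rewrite !ends //= -map_rcons updU; apply; first exact: lt_umsg.
  by apply/generator_transP; constructor.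
- move=> q a q' -> eG; have lt_a := letterG eG.
  have := @step_send M S (vmsg a) [:: q.*2; p1; p2] (chans cu cv cr ca cm) q'.*2.+1.
  rewrite !ends //= -map_rcons updV; apply; first exact: lt_vmsg.
  by apply/generator_transP; constructor.
- move=> q a q' ca' -> eG ea.
  have := @step_recv M S ackm [:: q'.*2.+1; p1; p2] (chans cu cv cr ca cm) (nseq ca' ackm) q'.*2.
  rewrite !ends //= updA ea; apply=> //; first exact: lt_ackm.
  by apply/generator_transP; apply: GenAck eG.
- move=> a cu' p1' lt_a eu tr.
  have := @step_recv M S (umsg a) [:: p0; p1; p2] (chans cu cv cr ca cm) (map umsg cu') p1'.
  rewrite !ends //= updU eu; apply => //; first exact: lt_umsg.
  exact/checker_transP.
- move=> a cr' p1' lt_a er tr.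
  have := @step_recv M S (rmsg a) [:: p0; p1; p2] (chans cu cv cr ca cm) (map rmsg cr') p1'.
  rewrite !ends //= updR er; apply => //; first exact: lt_rmsg.
  exact/checker_transP.
- move=> ->.
  have := @step_send M S goalm [:: p0; 2; p2] (chans cu cv cr ca cm) 1.
  rewrite !ends /= rcons_nseq updG; apply; first exact: lt_goalm.
  by apply/checker_transP; constructor.
- move=> a cv' lt_a ev ->.
  have := @step_recv M S (vmsg a) [:: p0; p1; 0] (chans cu cv cr ca cm) (map vmsg cv') a.+2.
  rewrite !ends //= updV ev; apply => //; first exact: lt_vmsg.
  by apply/relay_transP; constructor.
- move=> a lt_a ->.
  have := @step_send M S (rmsg a) [:: p0; p1; a.+2] (chans cu cv cr ca cm) 1.
  rewrite !ends //= -map_rcons updR; apply; first exact: lt_rmsg.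
  by apply/relay_transP; constructor.
- move=> ->.
  have := @step_send M S ackm [:: p0; p1; 1] (chans cu cv cr ca cm) 0.
  rewrite !ends /= rcons_nseq updA; apply; first exact: lt_ackm.
  by apply/relay_transP; constructor.
Qed.

(** Phases of the exchange of one letter of v between generator and relay. The node [q] advances
    only when the relay forwards the letter. [s0] and [s2] are the states of these two peers in the
    matching synchronous run, where every message sent is already received. *)
Inductive handshake (q : nat) : nat -> nat -> seq nat -> nat -> nat -> nat -> Prop :=
| Idle : handshake q q.*2 0 [::] 0 q.*2 0
| VSent a q' : (q, (false, a), q') \in G ->
    handshake q q'.*2.+1 0 [:: a] 0 q'.*2.+1 a.+2
| VReceived a q' : (q, (false, a), q') \in G ->
    handshake q q'.*2.+1 a.+2 [::] 0 q'.*2.+1 a.+2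
| Relayed p a : (p, (false, a), q) \in G ->
    handshake q q.*2.+1 1 [::] 0 q.*2.+1 1
| AckSent p a : (p, (false, a), q) \in G ->
    handshake q q.*2.+1 0 [::] 1 q.*2 0.

(** In [CkTrash] the relay word is nonempty because a relay letter caused the trash state; the other
    way into it, sending [goalm], is what [not_accepted] will exclude. *)
Inductive checked : nat -> seq nat -> seq nat -> Prop :=
| CkEqual w : checked 0 w w
| CkAhead w a : checked a.+3 (rcons w a) w
| CkEnd w : checked 2 (rcons w 0) w
| CkTrash u v : v != [::] -> checked 1 u v.

(** The coerced boolean [v != [::]] is the state of the checker in the synchronous run: 0 until the
    relay forwards a letter, the trash state 1 from then on. *)
Inductive simulated (w : seq nat) : config -> Prop :=
  Simulated q u v cu cv cr U R p0 p1 p2 ca s0 s2 of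
    gpath G q0 q u v & handshake q p0 p2 cv ca s0 s2 &
    u = U ++ cu & v = R ++ cr & checked p1 U R &
    reach M S (c0 S) (sync_trace w) (cfg s0 (v != [::]) s2 [::] [::] [::] 0 0) :
  simulated w (cfg p0 p1 p2 cu cv cr ca 0).

Lemma checked_recvU p a p' U R : checker_trans (p, Recv (umsg a), p') ->
  checked p U R -> checked p' (rcons U a) R.
Proof.
move E: (p, _, p') => t tr; case: tr E => //.
- by case=> -> /umsg_inj -> -> ck; inversion ck; constructor.
- by move=> b _ [-> /umsg_inj -> ->] ck; inversion ck; constructor.
- by move=> b _ [] _; rewrite /umsg /rmsg; lia.
- by move=> b _ [] _; rewrite /umsg /rmsg; lia.
- by move=> b _ [-> _ ->] ck; inversion ck; constructor.
- by move=> b _ [] _; rewrite /umsg /rmsg; lia.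
Qed.

Lemma checked_recvR p a p' U R : checker_trans (p, Recv (rmsg a), p') ->
  checked p U R -> checked p' U (rcons R a).
Proof.
move E: (p, _, p') => t tr; case: tr E => //.
- by case=> _; rewrite /umsg /rmsg; lia.
- by move=> b _ [] _; rewrite /umsg /rmsg; lia.
- by move=> b _ [-> /rmsg_inj -> ->] ck; inversion ck; constructor.
- by move=> b _ [_ _ ->] _; constructor; case: (R).
- by move=> b _ [] _; rewrite /umsg /rmsg; lia.
- by move=> b _ [_ _ ->] _; constructor; case: (R).
Qed.

Lemma sync_trace_reach w a c c1 c2 : reach M S (c0 S) (sync_trace w) c ->
  step M S c (Send a) c1 -> step M S c1 (Recv a) c2 ->
  reach M S (c0 S) (sync_trace (rcons w a)) c2.
Proof.
move=> r s1 s2; rewrite sync_trace_rcons.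
by apply: reach_rcons s2; apply: reach_rcons s1.
Qed.

Lemma c0_cfg : c0 S = cfg q0.*2 0 0 [::] [::] [::] 0 0.
Proof.
congr Config; apply: functional_extensionality => i.
by apply: functional_extensionality => j; case: i j => [|[|[|?]]] [|[|[|?]]].
Qed.

(* The graph writes ahead on the second stream, so that in a synchronous run
   the checker first hears from the relay and gives up. *)
Hypothesis write_ahead : forall q u v, gpath G q0 q u v -> prefix v u -> u = [::].

(** If v were empty, the edge would extend the path to one whose u is nonempty and has v as a
    prefix. *)
Lemma sync_checker_trash q u v a q' : gpath G q0 q u v ->
  (q, (true, a), q') \in G -> v != [::].
Proof.
move=> path eG; apply/eqP => v0; rewrite v0 in path.
by have := write_ahead (gpath_u path eG) (prefix0s _); case: (u).
Qed.

Section NotAccepted.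

Hypothesis not_accepted : forall q u v w,
  gpath G q0 q u v -> prefix (rcons w 0) u -> prefix w v -> False.

(** A reception leaves the synchronous run unchanged; an emission extends it by the same emission
    and its immediate reception. *)
Lemma simulated_step w c x c' :
  simulated w c -> step M S c x c' -> simulated (w ++ sends [:: x]) c'.
Proof.
case=> q u v cu cv cr U R p0 p1 p2 ca s0 s2 path hs eu ev ck rs /step_move.
case=> [q1 a q2 ep eG|q1 a q2 ep eG|q1 a q2 ca' ep eG ea|a cu' p1' lt_a ecu tr
  |a cr' p1' lt_a ecr tr|ep|a cv' lt_a ecv ep|a lt_a ep|ep] /=; rewrite ?cats0 ?cats1.
- have lt_a := letterG eG.
  (* The generator is in an even state, so by parity only the phase [Idle] remains. *)
  case: hs ep rs => [|b q3 _|b q3 _|p b _|p b _] ep rs; try by exfalso; lia.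
  have {}ep : q1 = q by lia.
  subst q1; have v0 := sync_checker_trash path eG.
  exists q2 (rcons u a) v U R q2.*2 0 => //; last 1 first.
  + apply: (sync_trace_reach rs); apply/step_move; rewrite v0; first exact: MvU eG.
    by apply: MvRecvU => //; constructor.
  + exact: gpath_u eG.
  + by constructor.
  + by rewrite eu rcons_cat.
- have lt_a := letterG eG.
  case: hs ep rs => [|b q3 _|b q3 _|p b _|p b _] ep rs; try by exfalso; lia.
  have {}ep : q1 = q by lia.
  subst q1; exists q u v U R q2.*2.+1 a.+2 => //; first by constructor.
  apply: (sync_trace_reach rs); apply/step_move; first exact: MvV eG.
  exact: MvRecvV.
- case: hs ep ea rs => [|b q3 _|b q3 _|p b _|p b eG'] ep ea rs; try by exfalso; lia.
  have [-> ->] : q2 = q /\ ca' = 0 by lia.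
  by exists q u v U R q.*2 0 => //; constructor.
- exists q u v (rcons U a) R s0 s2 => //; first by rewrite eu ecu cat_rcons.
  exact: checked_recvU ck.
- exists q u v U (rcons R a) s0 s2 => //; first by rewrite ev ecr cat_rcons.
  exact: checked_recvR ck.
(* Sending [goalm] requires state 2, where the words read witness acceptance of the path. *)
- exfalso; rewrite ep in ck; inversion ck as [| |w' eU eR|]; subst U R.
  by apply: (not_accepted (w := w') path); rewrite ?eu ?ev prefix_prefix.
- case: hs ecv ep rs => // b q3 eG [eb ecv] _ rs; subst b cv'.
  by exists q u v U R q3.*2.+1 a.+2 => //; constructor.
- case: hs ep rs => // b q3 eG [eb] rs; subst b.
  exists q3 u (rcons v a) U R q3.*2.+1 1 => //; last 1 first.
  + apply: (sync_trace_reach rs); apply/step_move; first exact: MvR.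
    (* Synchronously, the relayed letter meets the checker in state 0 or 1, and both lead to the
       trash state. *)
    have -> : (rcons v a != [::]) = true by case: (v).
    by apply: MvRecvR => //; case: (v != _); constructor.
  + exact: gpath_v eG.
  + exact: Relayed eG.
  + by rewrite ev rcons_cat.
- case: hs ep rs => // p b eG _ rs.
  exists q u v U R q.*2 0 => //; last 1 first.
  + apply: (sync_trace_reach rs); apply/step_move; first exact: MvAck.
    exact: MvRecvAck eG _.
  + exact: AckSent eG.
Qed.

Lemma reach_simulated t c : reach M S (c0 S) t c -> simulated (sends t) c.
Proof.
elim/last_ind: t c => [|t x IH] c.
  move=> r; inversion r; subst; rewrite c0_cfg.
  exists q0 [::] [::] [::] [::] q0.*2 0 => //; try by constructor.
  by rewrite -c0_cfg; apply: reach_nil.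
case/reach_rconsP => c' /IH sim st; rewrite -cats1 sends_cat.
exact: simulated_step st.
Qed.

(** The simulation preserves the word sent. When all channels are empty it also preserves the
    control states, because both runs are then in the same phase and have read the same words. *)
Theorem not_accepted_synchronizable : synchronizable M S.
Proof.
have word w : STw_of (inT M S 0) w <-> STw_of (inTomega M S) w.
  split=> [[t [[_ [c r]] es]]|[t [[k [_ [_ [c r]]]] es]]].
    by exists t; split=> //; apply: reach_inTomega r.
  exists (sync_trace w); split; last exact: sends_sync_trace.
  case: (reach_simulated r) => *; rewrite -es; apply/inT0_sync.
  by eexists; eassumption.
case=> [w|[w st]] /=; first exact: word.
split=> [[t [c [[_ tT] r stc es ec]]]|[t [c [tT r stc es ec]]]].
  by exists t, c; split=> //; apply: reach_inTomega r.
have := reach_simulated r; rewrite es => sim.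
move: sim stc ec => [] q u v cu cv cr U R p0 p1 p2 ca s0 s2 path hs eu ev ck rs stc <-.
have := (stc 0 1, stc 0 2, stc 2 1, stc 2 0) => /= -[[[]]].
case: cu cv cr ca hs eu ev {stc} => [|//] [|//] [|//] [|//] hs eu ev _ _ _ _.
rewrite !cats0 in eu ev; subst U R.
exists (sync_trace w), (cfg s0 (v != [::]) s2 [::] [::] [::] 0 0); split=> //.
- by apply/inT0_sync; eexists; eassumption.
- by case=> [|[|[|?]]] [|[|[|?]]].
- exact: sends_sync_trace.
- have [-> ->] : s0 = p0 /\ s2 = p2 by inversion hs.
  suff -> : p1 = (v != [::]) by [].
  (* In state 0 the words coincide, so writing ahead makes both empty; in the ahead and end states v
     would be a prefix of a nonempty u. *)
  case: ck path {hs rs} => [w1|w1 a|w1|u1 v1 ->] // path.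
  + by rewrite (write_ahead path (prefix_refl _)).
  + by have := write_ahead path (prefix_rcons _ _); case: (w1).
  + by have := write_ahead path (prefix_rcons _ _); case: (w1).
Qed.

End NotAccepted.

(** * Accepted paths break language synchronizability *)

Lemma generator_run q u v : gpath G q0 q u v ->
  exists t, reach M S (c0 S) t (cfg q.*2 0 0 u [::] v 0 0).
Proof.
elim=> [|p u1 v1 a q1 _ [t r] eG|p u1 v1 a q1 _ [t r] eG].
- by exists [::]; rewrite -c0_cfg; apply: reach_nil.
- by eexists; apply: reach_rcons r _; apply/step_move; apply: MvU eG.
- have lt_a := letterG eG.
  eexists; apply: reach_rcons (reach_rcons (reach_rcons (reach_rcons (reach_rcons r _) _) _) _) _.
  + by apply/step_move; apply: MvV erefl eG.
  + by apply/step_move; apply: MvRecvV lt_a erefl erefl.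
  + by apply/step_move; apply: MvR lt_a erefl.
  + by apply/step_move; apply: MvAck erefl.
  + by apply/step_move; apply: MvRecvAck erefl eG erefl.
Qed.

Lemma gpath_letters q u v : gpath G q0 q u v -> all (ltn^~ A) v.
Proof.
by elim=> // p u1 v1 a q1 _ IH /letterG /= lt_a; rewrite all_rcons /= lt_a.
Qed.

Lemma checker_run p0 p2 w cu cr : all (ltn^~ A) w -> exists t,
  reach M S (cfg p0 0 p2 (w ++ cu) [::] (w ++ cr) 0 0) t (cfg p0 0 p2 cu [::] cr 0 0).
Proof.
elim: w => [|a w IH] /=; first by exists [::]; apply: reach_nil.
case/andP=> lt_a /IH[t r]; eexists; apply: reach_cons _ (reach_cons _ r).
- by apply/step_move; apply: MvRecvU lt_a erefl (ChkU lt_a).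
- by apply/step_move; apply: MvRecvR lt_a erefl (ChkR lt_a).
Qed.

Lemma checker_recvR_trash p a p' :
  p < 2 -> checker_trans (p, Recv (rmsg a), p') -> p' = 1.
Proof.
move=> lt_p; move E: (_, _, _) => y tr.
by case: tr E lt_p => [||b _|b _|b _|b _|b _] [] //; rewrite /umsg /rmsg; lia.
Qed.

(** Synchronously the checker is confined to states 0 and 1, whereas [goalm] is sent from state 2
    only. *)
Lemma sync_reach w c : reach M S (c0 S) (sync_trace w) c ->
  exists q u v s0 s2, [/\ gpath G q0 q u v, handshake q s0 s2 [::] 0 s0 s2
    & c = cfg s0 (v != [::]) s2 [::] [::] [::] 0 0].
Proof.
elim/last_ind: w c => [|w k IH] c.
  move=> r; inversion r; subst; exists q0, [::], [::], q0.*2, 0.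
  by split; [constructor | constructor | rewrite c0_cfg].
rewrite sync_trace_rcons => /reach_rconsP[c2 /reach_rconsP[c1 /IH]].
case=> q [u [v [s0 [s2 [path hs ->]]]]] {c1 IH} /step_move.
move E1: (Send _) => x1 mv1; case: mv1 E1 => //.
- move=> q1 a q2 eq eG [->] {k}.
  have eqq : q1 = q by inversion hs; lia.
  have s2_0 : s2 = 0 by inversion hs; lia.
  subst q1; rewrite (sync_checker_trash path eG) => /step_move; move E2: (Recv _) => x2 mv2; case: mv2 E2 => //.
  move=> b cu p1' _ [_ <-] tr _; exists q2, (rcons u a), v, q2.*2, 0.
  split; [exact: gpath_u eG | constructor |].
  rewrite s2_0 (sync_checker_trash path eG).
  by move E: (_, _, _) tr => y tr; case: tr E => // b' _ [_ ->].
- move=> q1 a q2 eq eG [->] /step_move {k}.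
  have {}eq : q1 = q by inversion hs; lia.
  subst q1; move E2: (Recv _) => x2 mv2; case: mv2 E2 => //.
  move=> b cv _ [<- <-] _ _; exists q, u, v, q2.*2.+1, a.+2.
  by split=> //; apply: VReceived.
- by case: (v != _).
- move=> a _ ep [->] /step_move {k}; move E2: (Recv _) => x2 mv2; case: mv2 E2 => //.
  move=> b cr p1' _ [<- <-] tr _; move: hs; rewrite ep => hs.
  inversion hs as [|b' q2 eG|b' q2 eG e1 e2|p b' eG|p b' eG]; subst.
  exists q2, u, (rcons v a), q2.*2.+1, 1; split; [exact: gpath_v eG | exact: Relayed eG|].
  have -> : (rcons v a != [::]) by case: (v).
  by rewrite (checker_recvR_trash _ tr) //; case: (v != _).
- move=> ep [->] /step_move {k}; move E2: (Recv _) => x2 mv2; case: mv2 E2 => //.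
  move=> q1 b q2 ca' eq eG [<-] _; move: hs; rewrite ep => hs.
  inversion hs as [| | |p b' eG'|]; subst.
  have -> : q2 = q by lia.
  by exists q, u, v, q.*2, 0; split=> //; constructor.
Qed.

(** Both words are first written in full into the queues of an idle checker, which then reads [w]
    from both alternately, reads the end mark and sends [goalm]. No synchronous run sends a word
    ending in [goalm]. *)
Theorem accepted_not_lang_synchronizable q u v w :
  gpath G q0 q u v -> prefix (rcons w 0) u -> prefix w v ->
  ~ lang_synchronizable M S.
Proof.
move=> path /prefixP[u1 eu] /prefixP[v1 ev] sync.
have [t1 r1] := generator_run path; have lt_v := gpath_letters path.
have lt_w : all (ltn^~ A) w by move: lt_v; rewrite ev all_cat => /andP[].
have [t2 r2] := checker_run q.*2 0 (0 :: u1) v1 lt_w.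
have [c rt] : exists c,
    reach M S (c0 S) (rcons (rcons (t1 ++ t2) (Recv (umsg 0))) (Send goalm)) c.
  rewrite -cats1 -catA in eu; rewrite -eu -ev in r2.
  eexists; apply: reach_rcons (reach_rcons (reach_cat r1 r2) _) _.
  - by apply/step_move; apply: MvRecvU A_gt0 erefl ChkEnd.
  - by apply/step_move; apply: MvGoal.
have [|t [[[s et] [c1 r]]]] := (sync (sends (rcons (rcons (t1 ++ t2) (Recv (umsg 0))) (Send goalm)))).2.
  by eexists; split; first exact: reach_inTomega rt.
move: r; rewrite {t}et -/(sync_trace s) sends_sync_trace => r es.
move: r; rewrite {s}es -[rcons _ (Send _)]cats1 sends_cat cats1 sync_trace_rcons.
case/reach_rconsP=> c3 /reach_rconsP[c2 /sync_reach].
case=> q1 [u2 [v2 [s0 [s2 [_ _ ->]]]]] /step_move.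
move E: (Send _) => x mv _; case: mv E => //.
- by move=> ? a ? _ _ []; rewrite /goalm /umsg; lia.
- by move=> ? a ? _ _ []; rewrite /goalm /vmsg; lia.
- by case: (v2 != _).
- by move=> a _ _ []; rewrite /goalm /rmsg; lia.
Qed.

End QueueSystem.

(** * Counter machines as graphs *)

(** [endl] has to be 0, the letter the checker treats as end mark. [pad] is the extra emission of a
    rule that changes no register. *)
Definition endl := 0.
Definition sep := 1.
Definition pad := 2.
Definition regl r := r.+3.

(* A rule (f, x, pc') rewrites a block by copying letters other than f, with
   one extra emission x, and then moves control to pc'; f = sep forbids
   nothing, since separators are never copied. *)
Definition rule := (nat * (bool * nat) * nat)%type.

(** An extra letter on v increments, on u decrements. The two rules of a [DEC] are a guess that the
    check verifies: the zero branch cannot copy the letter of the register, the other branch must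
    find it in the block. *)
Definition rules (P : program) (pc : nat) : seq rule :=
  if pc < size P then
    match nth (INC 0) P pc with
    | INC r => [:: (sep, (false, regl r), pc.+1)]
    | DEC r j => [:: (regl r, (false, pad), j); (sep, (true, regl r), pc.+1)]
    end
  else [:: (sep, (true, endl), 0)].

Definition instr_below (K N : nat) (i : instr) : bool :=
  match i with INC r => r < K | DEC r j => (r < K) && (j < N) end.

Definition program_below (K N : nat) (P : program) : bool :=
  (size P < N) && all (instr_below K N) P.

(* Even nodes write the input; an odd node codes a phase t (0: copying before the
   extra emission of e, 1: copying after it, 2: separator written on v only,
   t' + 3: letter a read but not yet rewritten in phase t').  The lock keeps
   conversion from computing the codes. *)
Definition load (i : nat) : nat := i.*2.
Definition node (t : nat) (e : rule) (a : nat) : nat := (locked pickle (t, e, a)).*2.+1.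

Fixpoint load_edges (x : nat) : seq edge :=
  if x is i.+1 then (load i.+1, (false, regl 0), load i) :: load_edges i else [::].

Definition copy_edges (t : nat) (e : rule) (a : nat) : seq edge :=
  [:: (node t e 0, (true, a), node (t + 3) e a);
      (node (t + 3) e a, (false, a), node t e 0)].

Definition copied (K : nat) (e : rule) (a : nat) : bool := (1 < a < K + 3) && (a != e.1.1).

(** Separators go to v before u, so once u is nonempty v has strictly more of them; this is how the
    graph writes ahead. *)
Definition rule_edges (P : program) (K : nat) (e : rule) : seq edge :=
  (node 0 e 0, e.1.2, node 1 e 0) :: (node 2 e 0, (true, sep), node 0 e 0)
  :: [seq (node 1 e 0, (false, sep), node 2 e' 0) | e' <- rules P e.2]
  ++ flatten [seq copy_edges t e a | t <- [:: 0; 1], a <- filter (copied K e) (iota 0 (K + 3))].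

Definition all_rules (P : program) (N : nat) : seq rule :=
  flatten [seq rules P pc | pc <- iota 0 N].

Definition base_edges (P : program) (K N : nat) : seq edge :=
  [seq (load 0, (false, sep), node 0 e 0) | e <- rules P 0]
  ++ flatten [seq rule_edges P K e | e <- all_rules P N].

Definition counter_graph (P : program) (K N x : nat) : seq edge :=
  load_edges x ++ base_edges P K N.

Definition halts_on (P : program) (x : nat) : Prop :=
  exists n, size P <= (iter n (mstep P) (0, fun r => if r == 0 then x else 0)).1.

Section CounterGraph.

Variables (P : program) (K N x : nat).
Hypothesis K_gt0 : 0 < K.
Hypothesis belowP : program_below K N P.

Let ruleset := all_rules P N.
Let G := counter_graph P K N x.
Let path := gpath G (load x).

(** * Edges and rules in inductive form *)

Inductive graph_edge : edge -> Prop :=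
| GLoad i : i < x -> graph_edge (load i.+1, (false, regl 0), load i)
| GStart e : e \in rules P 0 -> graph_edge (load 0, (false, sep), node 0 e 0)
| GExit e : e \in ruleset -> graph_edge (node 0 e 0, e.1.2, node 1 e 0)
| GSepV e e' : e \in ruleset -> e' \in rules P e.2 ->
    graph_edge (node 1 e 0, (false, sep), node 2 e' 0)
| GSepU e : e \in ruleset -> graph_edge (node 2 e 0, (true, sep), node 0 e 0)
| GCopyU t e a : t < 2 -> e \in ruleset -> copied K e a ->
    graph_edge (node t e 0, (true, a), node (t + 3) e a)
| GCopyV t e a : t < 2 -> e \in ruleset -> copied K e a ->
    graph_edge (node (t + 3) e a, (false, a), node t e 0).

Lemma graph_edgeP e : e \in G <-> graph_edge e.
Proof.
have loadP e1 : e1 \in load_edges x <->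
    exists2 i, i < x & e1 = (load i.+1, (false, regl 0), load i).
  elim: (x) => [|i IH] /=; first by split=> // -[].
  rewrite inE; split=> [/orP[/eqP->|/IH[j lt_j ->]]|[j]]; first by exists i.
    by exists j => //; apply: ltnW.
  rewrite ltnS leq_eqVlt => /orP[/eqP->->|lt_j ej]; first by rewrite eqxx.
  by apply/orP; right; apply/IH; exists j.
rewrite !mem_cat; split.
  case/or3P=> [/loadP[i lt_i ->]|/mapP[e1 R1 ->]|/flattenP[s /mapP[e1 R1 ->]]].
  - by constructor.
  - by constructor.
  rewrite !inE mem_cat => /or4P[/eqP->|/eqP->|/mapP[e2 R2 ->]|]; try by constructor.
  case/flattenP=> s1 /allpairsP[[t a] /= [tt]]; rewrite mem_filter => /andP[cp _] ->.
  have {tt} lt_t : t < 2 by move: tt; rewrite !inE => /orP[]/eqP->.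
  by rewrite !inE => /orP[]/eqP->; constructor.
have ruleE e1 s : e1 \in ruleset -> s \in rule_edges P K e1 ->
    s \in flatten [seq rule_edges P K e | e <- all_rules P N].
  by move=> R1 e1s; apply/flattenP; exists (rule_edges P K e1); rewrite ?map_f.
have copyE t e1 a s : t < 2 -> e1 \in ruleset -> copied K e1 a ->
    s \in copy_edges t e1 a ->
    s \in flatten [seq rule_edges P K e | e <- all_rules P N].
  move=> lt_t R1 cp es; apply: (ruleE e1) => //.
  rewrite !inE mem_cat; apply/or4P; constructor 4.
  apply/flattenP; exists (copy_edges t e1 a) => //.
  apply/allpairsP; exists (t, a); split=> //=.
    by case: t lt_t {es} => [|[|]].
  by rewrite mem_filter cp mem_iota; case/andP: cp => /andP[].
case=> [i lt_i|e1 R1|e1 R1|e1 e2 R1 R2|e1 R1|t e1 a lt_t R1 cp|t e1 a lt_t R1 cp];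
  apply/or3P.
- by constructor 1; apply/loadP; exists i.
- by constructor 2; apply/map_f.
- by constructor 3; apply: (ruleE e1) => //; rewrite !inE eqxx.
- constructor 3; apply: (ruleE e1) => //; rewrite !inE mem_cat.
  by apply/or4P; constructor 3; apply: map_f.
- by constructor 3; apply: (ruleE e1) => //; rewrite !inE eqxx orbT.
- by constructor 3; apply: (copyE t e1 a) => //; rewrite !inE eqxx.
- by constructor 3; apply: (copyE t e1 a) => //; rewrite !inE eqxx orbT.
Qed.

Inductive rule_spec (pc : nat) : rule -> Prop :=
| RuleInc r of pc < size P & nth (INC 0) P pc = INC r & r < K :
    rule_spec pc (sep, (false, regl r), pc.+1)
| RuleZero r j of pc < size P & nth (INC 0) P pc = DEC r j & r < K & j < N :
    rule_spec pc (regl r, (false, pad), j)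
| RuleDec r j of pc < size P & nth (INC 0) P pc = DEC r j & r < K :
    rule_spec pc (sep, (true, regl r), pc.+1)
| RuleHalt of size P <= pc : rule_spec pc (sep, (true, endl), 0).

Lemma rulesP pc e : e \in rules P pc -> rule_spec pc e.
Proof.
rewrite /rules; case: ltnP => [lt_pc|]; last by rewrite inE => ? /eqP->; constructor.
have : instr_below K N (nth (INC 0) P pc).
  by case/andP: belowP => _ /(all_nthP (INC 0)); apply.
case Ei: (nth _ P pc) => [r|r j] /=; first by rewrite inE => lt_r /eqP->; constructor.
by case/andP=> lt_r lt_j; rewrite !inE => /orP[]/eqP->; econstructor; eauto.
Qed.

Lemma N_gt0 : 0 < N. Proof. by case/andP: belowP => /(leq_trans _)->. Qed.

Lemma rules_ruleset pc e : pc < N -> e \in rules P pc -> e \in ruleset.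
Proof.
by move=> lt_pc e_pc; apply/flattenP; exists (rules P pc); rewrite ?map_f ?mem_iota.
Qed.

Lemma rulesetP e : e \in ruleset -> exists2 pc, e \in rules P pc & e.2 < N.
Proof.
case/flattenP=> s /mapP[pc]; rewrite mem_iota add0n => /andP[_ lt_pc] -> e_pc.
exists pc => //; case/andP: belowP => ltN _.
by case: (rulesP e_pc) => [r ? ? ?|r j ? ? ? ?|r j ? ? ?|?] /=; lia.
Qed.

Lemma letter_graph e : e \in G -> e.1.2.2 < K + 3.
Proof.
move/graph_edgeP=> eG; have N0 := N_gt0.
case: eG => [i _|e1 _|e1 /rulesetP[pc e_pc _]|e1 e2 _ _|e1 _|t e1 a _ _ cp|t e1 a _ _ cp] /=;
  rewrite /regl /sep; try lia; try by move: cp; rewrite /copied; lia.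
by case: (rulesP e_pc) => [r|r j|r j|]; rewrite /= /regl /pad /endl; lia.
Qed.

(** * Invariant of graph paths: acceptance implies halting *)

Let init : mstate := (0, fun r => if r == 0 then x else 0).

Definition reached (pc : nat) (rho : nat -> nat) := exists n, iter n (mstep P) init = (pc, rho).

Definition represents (d : seq nat) (rho : nat -> nat) :=
  forall r, r < K -> count_mem (regl r) d = rho r.

(** Equality up to permutation, since the extra letter may be emitted anywhere in a block and only
    multiplicities encode registers. *)
Definition rewritten (e : rule) (c c' : seq nat) : bool :=
  if e.1.2.1 then perm_eq c (e.1.2.2 :: c') else perm_eq c' (e.1.2.2 :: c).

Lemma count_mem_cons (a b : nat) s : count_mem a (b :: s) = (b == a) + count_mem a s.
Proof. by []. Qed.

Lemma rewritten_step pc rho e d d' : reached pc rho -> e \in rules P pc ->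
  represents d rho -> e.1.1 \notin d -> endl \notin d -> rewritten e d d' ->
  exists2 rho', reached e.2 rho' & represents d' rho'.
Proof.
move=> [n en] /rulesP e_pc rep.
have next pc' rho' : mstep P (pc, rho) = (pc', rho') -> reached pc' rho'.
  by move=> st; exists n.+1; rewrite iterS en.
case: e_pc next => [r lt_pc ei lt_r|r j lt_pc ei lt_r lt_j|r j lt_pc ei lt_r|le_pc];
  rewrite /rewritten /= => next forb nend /permP pe.
- eexists; first by apply: next; rewrite lt_pc ei.
  move=> r1 lt_r1; rewrite pe /= rep //.
  by rewrite /regl !eqSS eq_sym; case: eqP => // ->.
(* The zero guess was right, because the forbidden letter does not occur in [d]. *)
- have rho0 : rho r = 0 by rewrite -rep //; apply/count_memPn.
  exists rho; first by apply: next; rewrite lt_pc ei rho0.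
  by move=> r1 lt_r1; rewrite pe /= rep.
- have pos : rho r = (rho r).-1.+1.
    by rewrite -rep // pe (count_mem_cons _ _ d') eqxx.
  eexists; first by apply: next; rewrite lt_pc ei pos /=; reflexivity.
  move=> r1 lt_r1; have := pe (pred1 (regl r1)); rewrite rep //= /regl !eqSS eq_sym.
  by case: eqP => [->|_] ->.
(* The halting rule would need [endl] in [d]. *)
- by have := pe (pred1 endl); rewrite (count_memPn nend).
Qed.

(* u has copied the part c of the block d that follows the common prefix s,
   while v is writing the successor c' of d. *)
Definition in_round (t : nat) (e : rule) (u v : seq nat) :=
  exists s c c' d, [/\ u = s ++ c, v = s ++ d ++ sep :: c',
    [/\ sep \notin c, sep \notin c', sep \notin d & e.1.1 \notin c],
    (if t == 0 then c' = c else rewritten e c c')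
  & exists pc rho, [/\ reached pc rho, e \in rules P pc & represents d rho]].

(** The lead of v in separators holds on all paths, the description of the round only while u is
    still a prefix of v. In phase 2 the lead is at least two, v having a separator that u still
    owes. *)
Definition node_inv (t : nat) (e : rule) (a : nat) (u v : seq nat) : Prop :=
  match t with
  | 2 => (count_mem sep u).+1 < count_mem sep v /\
      (prefix u v -> exists e' v', [/\ e \in rules P e'.2, v = rcons v' sep
                                 & in_round 1 e' u v'])
  | t'.+3 => count_mem sep u < count_mem sep v /\
      (prefix u v -> exists2 u', u = rcons u' a & in_round t' e u' v)
  | _ => count_mem sep u < count_mem sep v /\ (prefix u v -> in_round t e u v)
  end.

Definition state_inv (q : nat) (u v : seq nat) : Prop :=
  if odd q then
    if unpickle q./2 is Some (t, e, a) then node_inv t e a u v else False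
  else u = [::] /\ v = nseq (x - q./2) (regl 0).

Lemma state_inv_node t e a u v : state_inv (node t e a) u v = node_inv t e a u v.
Proof. by rewrite /state_inv /= odd_double uphalf_double -lock pickleK. Qed.

Lemma state_inv_load i u v :
  state_inv (load i) u v = (u = [::] /\ v = nseq (x - i) (regl 0)).
Proof. by rewrite /state_inv odd_double doubleK. Qed.

Lemma state_inv_ahead q u v : state_inv q u v ->
  u = [::] \/ count_mem sep u < count_mem sep v.
Proof.
rewrite /state_inv; case: odd; last by case; left.
case: unpickle => // -[[t e] a]; case: t => [|[|[|t]]] /= [lt_uv _]; right => //.
exact: ltnW.
Qed.

Lemma in_round_copy t e u v a : a != sep -> a != e.1.1 ->
  in_round t e u v -> in_round t e (rcons u a) (rcons v a).
Proof.
move=> a_sep a_f [s [c [c' [d [-> -> [nc nc' nd nf] ecc st]]]]].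
exists s, (rcons c a), (rcons c' a), d; rewrite !rcons_cat; split=> //.
  by rewrite !mem_rcons !inE ![_ == a]eq_sym (negPf a_sep) (negPf a_f).
case: (t == 0) ecc => [->//|]; rewrite /rewritten.
case: e.1.2.1 => pe; rewrite -!cats1 -cat_cons.
  by rewrite perm_cat2r.
by rewrite perm_cat2r.
Qed.

(** A u covering all of v and the new letter would have at least as many separators as v. So writing
    on v never repairs a mismatch. *)
Lemma prefix_rcons_ahead (u v : seq nat) a : count_mem sep u < count_mem sep v ->
  prefix u (rcons v a) -> prefix u v.
Proof.
move=> lt_uv /prefixP[s]; case/lastP: s => [|s b].
  by rewrite cats0 => eu; move: lt_uv; rewrite -eu -cats1 count_cat; lia.
by rewrite -rcons_cat => /rcons_inj[-> _]; apply: prefix_prefix.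
Qed.

Lemma block_eq (c d s : seq nat) : sep \notin c -> sep \notin d ->
  prefix (rcons c sep) (d ++ sep :: s) -> c = d.
Proof.
elim: c d => [|a c IH] [|b d] //=.
- by rewrite inE negb_or => _ /andP[/negPf->].
- by rewrite inE negb_or => /andP[nsa _] _ /andP[/eqP ea]; rewrite ea eqxx in nsa.
- by rewrite !inE !negb_or => /andP[_ nc] /andP[_ nd] /andP[/eqP-> /(IH _ nc nd)->].
Qed.

Definition halted := exists pc rho, reached pc rho /\ size P <= pc.

Lemma exit_letter pc e : e \in rules P pc -> e.1.2.2 != sep.
Proof. by case/rulesP. Qed.

Lemma exit_forbidden pc e : e \in rules P pc -> e.1.2.1 -> e.1.2.2 != e.1.1.
Proof. by case/rulesP. Qed.

Lemma prefix_rconsW (u v : seq nat) a : prefix (rcons u a) v -> prefix u v.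
Proof. exact/prefix_trans/prefix_rcons. Qed.

Lemma count_sep_rcons s a : count_mem sep (rcons s a) = count_mem sep s + (a == sep).
Proof. by rewrite -cats1 count_cat /= addn0. Qed.

Lemma copied_sep e a : copied K e a -> a != sep.
Proof. by case/andP=> /andP[lt_a _] _; rewrite neq_ltn lt_a orbT. Qed.

Lemma in_round_exitU e u v a : a != sep -> e.1.2 = (true, a) ->
  in_round 0 e u v -> in_round 1 e (rcons u a) v.
Proof.
move=> a_sep ea [s [c [c' [d [-> -> [nc nc' nd nf] /= ecc st]]]]].
have a_f : a != e.1.1.
  by case: st => pc [rho [_ /exit_forbidden + _]]; rewrite ea => ->.
exists s, (rcons c a), c', d; rewrite rcons_cat ecc.
rewrite ecc in nc'; split=> //.
  by rewrite !mem_rcons !inE ![_ == a]eq_sym (negPf a_sep) (negPf a_f).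
by rewrite /rewritten ea /= perm_rcons.
Qed.

Lemma in_round_exitV e u v a : a != sep -> e.1.2 = (false, a) ->
  in_round 0 e u v -> in_round 1 e u (rcons v a).
Proof.
move=> a_sep ea [s [c [c' [d [-> -> [nc nc' nd nf] /= ecc st]]]]].
exists s, c, (rcons c' a), d; rewrite !rcons_cat ecc.
rewrite ecc in nc'; split=> //.
  by rewrite !mem_rcons !inE ![_ == a]eq_sym (negPf a_sep).
by rewrite /rewritten ea /= perm_rcons.
Qed.

(** Here the check acts: since the closing separators match, the block [c] copied by u is the block
    [d] of v. The successor [c'] then represents the next machine state and becomes the current
    block. *)
Lemma in_round_next e e' u v : endl \notin v -> e' \in rules P e.2 ->
  prefix (rcons u sep) (rcons v sep) -> in_round 1 e u v ->
  in_round 0 e' (rcons u sep) (rcons v sep).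
Proof.
move=> nv e'e pf [s [c [c' [d [eu ev [nc nc' nd nf] /= ecc]]]]]; subst u v.
move: nv pf; rewrite !mem_cat in_cons !negb_or => /and4P[_ nde _ nc'e].
rewrite !rcons_cat prefix_catr // eqxx rcons_cons => /(block_eq nc nd) ecd.
case=> pc [rho [rc e_pc rep]]; rewrite -ecd in nde rep *.
have [rho' rc' rep'] := rewritten_step rc e_pc rep nf nde ecc.
exists (s ++ rcons c sep), [::], [::], c'; split=> //.
- by rewrite cats0.
- by rewrite -!cats1 /= -!catA.
- by exists e.2, rho'.
Qed.

Lemma state_inv_u q u v a q' : (q, (true, a), q') \in G -> endl \notin v ->
  state_inv q u v -> [/\ state_inv q' (rcons u a) v, count_mem sep u < count_mem sep v
    & prefix u v -> a = endl -> halted].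
Proof.
move=> /graph_edgeP; move Ed: (_, _, q') => ed eG nv; case: eG Ed => //.
- move=> e1 /rulesetP[pc0 /exit_letter a_sep _] [-> ea ->].
  rewrite -ea /= in a_sep; rewrite !state_inv_node /= => -[lt_uv rd].
  rewrite count_sep_rcons (negPf a_sep) addn0; split=> //.
    by split=> // /prefix_rconsW/rd; apply: in_round_exitU.
  (* Only the halting rule emits [endl], so the control point reached lies past the end of the
     program. *)
  move=> /rd[s [c [c' [d [_ _ _ _ [pc [rho [rc e_pc _]]]]]]]] a0; exists pc, rho; split=> //.
  by move: e_pc ea; rewrite a0; case/rulesP.
- move=> e1 R1 [-> -> ->]; rewrite !state_inv_node /= => -[lt_uv rd]; split=> //.
    rewrite count_sep_rcons addn1; split=> // uv.
    have [e' [v' [e1e' ev rd']]] := rd (prefix_rconsW uv).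
    rewrite ev in nv uv *; apply: in_round_next rd' => //.
    by apply: contra nv; rewrite mem_rcons inE => ->; rewrite orbT.
  exact: ltnW.
- move=> t e1 b lt_t R1 cp [-> -> ->]; have b_sep := copied_sep cp.
  rewrite !state_inv_node addn3 => inv.
  have [lt_uv rd] : count_mem sep u < count_mem sep v /\ (prefix u v -> in_round t e1 u v).
    by case: t lt_t inv => [|[|//]].
  split=> //=; last by move=> _ b0; move: cp; rewrite b0.
  rewrite count_sep_rcons (negPf b_sep) addn0; split=> // /prefix_rconsW/rd.
  by exists u.
Qed.

Lemma state_inv_v q u v a q' : (q, (false, a), q') \in G ->
  state_inv q u v -> state_inv q' u (rcons v a) /\ a != endl.
Proof.
move=> /graph_edgeP; move Ed: (_, _, q') => ed eG; case: eG Ed => //.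
- move=> i lt_i [-> -> ->]; rewrite !state_inv_load => -[-> ->].
  by rewrite rcons_nseq -subSn // subSS.
- move=> e1 R1 [-> -> ->]; rewrite state_inv_load state_inv_node subn0 => -[-> ->].
  split=> //; split=> [|_]; first by rewrite count_sep_rcons addn1.
  exists [::], [::], [::], (nseq x (regl 0)); rewrite cats1; split=> //.
    by split=> //; rewrite mem_nseq andbF.
  exists 0, (fun r => if r == 0 then x else 0); split=> //; first by exists 0.
  by move=> r _; rewrite count_nseq /regl /= !eqSS eq_sym; case: eqP => //; rewrite mul1n.
- move=> e1 /rulesetP[pc0 R0 _] [-> ea ->]; have a_sep := exit_letter R0.
  rewrite -ea /= in a_sep; rewrite !state_inv_node /= => -[lt_uv rd]; split.
    split; first by rewrite count_sep_rcons (leq_trans lt_uv) ?leq_addr.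
    by move=> /(prefix_rcons_ahead lt_uv)/rd; apply: in_round_exitV.
  by case: (rulesP R0) ea => [r _ _ _|r j _ _ _ _|r j _ _ _|_] //= [->].
- move=> e1 e2 R1 e12 [-> -> ->]; rewrite !state_inv_node /= => -[lt_uv rd]; split=> //.
  split; first by rewrite count_sep_rcons addn1.
  by move=> /(prefix_rcons_ahead lt_uv)/rd; exists e1, v.
- move=> t e1 b lt_t R1 cp [-> -> ->]; have b_sep := copied_sep cp.
  rewrite !state_inv_node addn3 => -[lt_uv rd]; split; last first.
    by apply: contraTN cp => /eqP ->.
  suff: count_mem sep u < count_mem sep (rcons v b) /\
        (prefix u (rcons v b) -> in_round t e1 u (rcons v b)).
    by case: t lt_t {rd} => [|[|//]].
  split; first by rewrite count_sep_rcons (leq_trans lt_uv) ?leq_addr.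
  move=> /(prefix_rcons_ahead lt_uv)/rd[u' -> rd']; apply: in_round_copy => //.
  by case/andP: cp.
Qed.

Lemma gpath_inv q u v : path q u v ->
  [/\ state_inv q u v, endl \notin v
    & forall w, prefix (rcons w endl) u -> prefix w v -> halted].
Proof.
elim=> {q u v} [|q u v a q' _ [inv nv acc] eG|q u v a q' _ [inv nv acc] eG].
- by split=> [||w] //; [rewrite state_inv_load subnn | case: w].
- have [inv' lt_uv halt] := state_inv_u eG nv inv; split=> // w /prefixP[s].
  (* Either [w] and its end mark already lay inside u, or the end mark is the letter just
     emitted. *)
  case/lastP: s => [|s b]; last first.
    by rewrite -rcons_cat => /rcons_inj[eu _]; apply: acc; rewrite eu prefix_prefix.
  by rewrite cats0 => /rcons_inj[<- a0] /halt; apply.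
- have [inv' a_end] := state_inv_v eG inv; split=> //.
    by rewrite mem_rcons inE negb_or eq_sym a_end.
  move=> w wu; have lt_uv : count_mem sep u < count_mem sep v.
    by have [u0|//] := state_inv_ahead inv; move: wu; rewrite u0; case: (w).
  have [s eu] := prefixP wu.
  (* As part of u, [w] has fewer separators than v, so it does not reach the letter just appended to
     v. *)
  have le_wu : count_mem sep w <= count_mem sep u.
    by rewrite eu count_cat -cats1 count_cat -addnA leq_addr.
  by move/(prefix_rcons_ahead (leq_ltn_trans le_wu lt_uv)); apply: acc.
Qed.

Lemma graph_write_ahead q u v : path q u v -> prefix v u -> u = [::].
Proof.
case/gpath_inv=> /state_inv_ahead[//|lt_uv] _ _ /prefixP[s eu].
by move: lt_uv; rewrite eu count_cat; lia.
Qed.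

Lemma graph_sound q u v w :
  path q u v -> prefix (rcons w endl) u -> prefix w v -> halts_on P x.
Proof.
by case/gpath_inv=> _ _ acc /acc{}acc /acc[pc [rho [[n en] le_pc]]]; exists n; rewrite en.
Qed.

(** * Paths following a run of the machine: halting implies acceptance *)

Lemma load_path i : i <= x -> path (load (x - i)) [::] (nseq i (regl 0)).
Proof.
elim: i => [|i IH] lt_i; first by rewrite subn0; constructor.
rewrite -rcons_nseq; apply: gpath_v (IH (ltnW lt_i)) _; apply/graph_edgeP.
by have -> : x - i = (x - i.+1).+1; [lia | constructor; lia].
Qed.

Lemma copy_path t e u v w : t < 2 -> e \in ruleset -> all (copied K e) w ->
  path (node t e 0) u v -> path (node t e 0) (u ++ w) (v ++ w).
Proof.
move=> lt_t R1; elim: w u v => [|a w IH] u v /=; first by rewrite !cats0.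
case/andP=> cp /IH{}IH uv; rewrite -!cat_rcons; apply: IH.
by apply: (gpath_v (gpath_u uv _)); apply/graph_edgeP; constructor.
Qed.

(** The extra letter is emitted between the copies of [c1] and [c2]; it belongs to the old block if
    emitted on u and to the new one if emitted on v. *)
Lemma round_path e e' s d c1 c2 : e \in ruleset -> e' \in rules P e.2 ->
  all (copied K e) (c1 ++ c2) ->
  d = c1 ++ (if e.1.2.1 then [:: e.1.2.2] else [::]) ++ c2 ->
  path (node 0 e 0) s (s ++ rcons d sep) ->
  path (node 0 e' 0) (s ++ rcons d sep)
    ((s ++ rcons d sep) ++
     rcons (c1 ++ (if e.1.2.1 then [::] else [:: e.1.2.2]) ++ c2) sep).
Proof.
move=> R1 R2; rewrite all_cat => /andP[cp1 cp2] ed /(copy_path (ltn0Sn 1) R1 cp1) uv1.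
have R2' : e' \in ruleset.
  by have [pc _ lt_pc] := rulesetP R1; apply: rules_ruleset R2.
have eG : (node 0 e 0, e.1.2, node 1 e 0) \in G by apply/graph_edgeP; constructor.
have uv2 : path (node 1 e 0) (s ++ c1 ++ (if e.1.2.1 then [:: e.1.2.2] else [::]))
    ((s ++ rcons d sep) ++ c1 ++ (if e.1.2.1 then [::] else [:: e.1.2.2])).
  move: eG; case: (e.1.2) => -[] a eG /=; rewrite cats0 cats1 -[_ ++ rcons c1 a]rcons_cat.
    exact: gpath_u uv1 eG.
  exact: gpath_v uv1 eG.
have := copy_path (ltnSn 1) R1 cp2 uv2; rewrite -!catA -ed => uv3.
rewrite -[rcons d sep ++ _]rcons_cat -[s ++ rcons (_ ++ _) _]rcons_cat.
rewrite -[s ++ rcons d sep]rcons_cat.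
apply: gpath_u; last by apply/graph_edgeP; apply: GSepU.
apply: gpath_v uv3 _.
by apply/graph_edgeP; constructor.
Qed.

(** The path is required for every rule of [pc], because the node entered after a separator already
    commits to the rule of the coming round. *)
Lemma run_path n : let: (pc, rho) := iter n (mstep P) init in
  exists s d, [/\ pc < N, represents d rho, all (fun a => 1 < a < K + 3) d
    & forall e, e \in rules P pc -> path (node 0 e 0) s (s ++ rcons d sep)].
Proof.
elim: n => [|n].
  exists [::], (nseq x (regl 0)); split; first exact: N_gt0.
  - by move=> r _; rewrite count_nseq /regl /= !eqSS eq_sym; case: eqP => //; rewrite mul1n.
  - by rewrite all_nseq addn3 !ltnS K_gt0 orbT.
  move=> e e0; rewrite cat0s; apply: (@gpath_v _ _ (load 0)); last by apply/graph_edgeP; constructor.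
  by have := load_path (leqnn x); rewrite subnn.
rewrite iterS; case: (iter _ _ _) => pc rho [s [d [lt_pc rep let_d pth]]].
rewrite /mstep; case: ltnP => [lt_sz|_]; last by exists s, d.
have : instr_below K N (nth (INC 0) P pc).
  by case/andP: belowP => _ /(all_nthP (INC 0)); apply.
have le_size : size P < N by case/andP: belowP.
have inP e : e \in rules P pc -> e \in ruleset by apply: rules_ruleset.
have copied_all f y pc' w : all (fun a => 1 < a < K + 3) w -> f \notin w ->
    all (copied K (f, y, pc')) w.
  move=> /allP lw fw; apply/allP => a aw; rewrite /copied lw //=.
  by apply: contraNneq fw => <-.
have sepN w : all (fun a => 1 < a < K + 3) w -> sep \notin w.
  by move=> /allP lw; apply/negP => /lw.
case ei: (nth _ P pc) => [r|r j] /= => [lt_r|/andP[lt_r lt_j]].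
- have R1 : (sep, (false, regl r), pc.+1) \in rules P pc by rewrite /rules lt_sz ei inE eqxx.
  (* The whole block is copied before the extra letter: [c1] is [d] and [c2] is empty. *)
  exists (s ++ rcons d sep), (d ++ [:: regl r] ++ [::]); split; first exact: leq_ltn_trans le_size.
  + move=> r1 /rep <-; rewrite count_cat count_mem_cons addn0 addnC /regl !eqSS eq_sym.
    by case: eqP => // ->; rewrite -rep.
  + by rewrite all_cat let_d /= addn3 !ltnS lt_r.
  move=> e' R2; apply: (round_path (inP _ R1) R2); last exact: pth.
    by rewrite cats0 copied_all ?sepN.
  by rewrite !cats0.
- case: eqP => [rho0|/eqP rho_gt0].
    have R1 : (regl r, (false, pad), j) \in rules P pc by rewrite /rules lt_sz ei inE eqxx.
    exists (s ++ rcons d sep), (d ++ [:: pad] ++ [::]); split=> //.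
    + by move=> r1 /rep <-; rewrite count_cat addn0.
    + by rewrite all_cat let_d /= addn3.
    move=> e' R2; apply: (round_path (inP _ R1) R2); last exact: pth.
      rewrite cats0 copied_all //.
      by apply/count_memPn; rewrite rep.
    by rewrite !cats0.
  have R1 : (sep, (true, regl r), pc.+1) \in rules P pc.
    by rewrite /rules lt_sz ei !inE eqxx orbT.
  have rd : regl r \in d by rewrite -has_pred1 has_count rep ?lt0n.
  (* The block is cut at an occurrence of the letter to be removed. *)
  case/splitPr: {d} rd rep let_d pth => c1 c2 rep let_d pth.
  exists (s ++ rcons (c1 ++ regl r :: c2) sep), (c1 ++ [::] ++ c2).
  have let_c : all (fun a => 1 < a < K + 3) (c1 ++ c2).
    by move: let_d; rewrite !all_cat /= => /and3P[-> _ ->].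
  split=> //; first exact: leq_ltn_trans le_size.
    move=> r1 lt_r1; have := rep _ lt_r1.
    rewrite !count_cat count_mem_cons /regl !eqSS eq_sym; by case: eqP => [->|_] <- /=; lia.
  move=> e' R2; apply: (round_path (inP _ R1) R2); last exact: pth; last by [].
  by rewrite copied_all ?sepN.
Qed.

Lemma graph_complete : halts_on P x ->
  exists q u v w, [/\ path q u v, prefix (rcons w endl) u & prefix w v].
Proof.
case=> n; have := run_path n; rewrite -/init; case: (iter _ _ _) => pc rho /=.
case=> s [d [lt_pc _ _ pth]] le_pc; pose e : rule := (sep, (true, endl), 0).
have R1 : e \in rules P pc by rewrite /rules ltnNge le_pc inE.
(* The end mark is emitted on u right after the common prefix [s], without reading the last block of
   v. *)
exists (node 1 e 0), (rcons s endl), (s ++ rcons d sep), s.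
split; [|exact: prefix_refl|exact: prefix_prefix].
apply: gpath_u (pth _ R1) _; apply/graph_edgeP; apply: (@GExit e).
exact: rules_ruleset R1.
Qed.

End CounterGraph.

(** * A loop language compiled to counter machines *)

Inductive cmd := Skip | Incr of nat | Then of cmd & cmd | Loop of nat & cmd.

Definition setr (r v : nat) (s : nat -> nat) : nat -> nat :=
  fun r' => if r' == r then v else s r'.

Fixpoint den (c : cmd) (s : nat -> nat) : nat -> nat :=
  match c with
  | Skip => s
  | Incr r => setr r (s r).+1 s
  | Then c1 c2 => den c2 (den c1 s)
  | Loop r c1 => iter (s r) (fun s' => den c1 (setr r (s' r).-1 s')) s
  end.

Fixpoint modifies (c : cmd) (r : nat) : bool :=
  match c with
  | Skip => false
  | Incr r' => r == r'
  | Then c1 c2 => modifies c1 r || modifies c2 r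
  | Loop r' c1 => (r == r') || modifies c1 r
  end.

(* The body of a loop must not change the loop counter: only then does den,
   which fixes the number of iterations in advance, describe the compiled code. *)
Fixpoint loops_ok (c : cmd) : bool :=
  match c with
  | Then c1 c2 => loops_ok c1 && loops_ok c2
  | Loop r c1 => loops_ok c1 && ~~ modifies c1 r
  | _ => true
  end.

Fixpoint cmd_size (c : cmd) : nat :=
  match c with
  | Skip => 0
  | Incr _ => 1
  | Then c1 c2 => cmd_size c1 + cmd_size c2
  | Loop _ c1 => (cmd_size c1).+2
  end.

(* z is a register that stays 0, so that DEC z j is an unconditional jump. *)
Fixpoint compile (z o : nat) (c : cmd) : program :=
  match c with
  | Skip => [::]
  | Incr r => [:: INC r]
  | Then c1 c2 => compile z o c1 ++ compile z (o + cmd_size c1) c2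
  | Loop r c1 => DEC r (o + (cmd_size c1).+2) :: compile z o.+1 c1 ++ [:: DEC z o]
  end.

Lemma size_compile z o c : size (compile z o c) = cmd_size c.
Proof.
elim: c o => [|r|c1 IH1 c2 IH2|r c1 IH1] o //=; first by rewrite size_cat IH1 IH2.
by rewrite size_cat IH1 addn1.
Qed.

Definition runs (P : program) (s s' : mstate) := exists n, iter n (mstep P) s = s'.

Lemma runs_refl P s : runs P s s. Proof. by exists 0. Qed.

Lemma runs_trans P s1 s2 s3 : runs P s1 s2 -> runs P s2 s3 -> runs P s1 s3.
Proof. by move=> [n1 e1] [n2 e2]; exists (n2 + n1); rewrite iterD e1. Qed.

Lemma runs1 P s s' : mstep P s = s' -> runs P s s'. Proof. by exists 1. Qed.

Lemma den_unmodified c s r : ~~ modifies c r -> den c s r = s r.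
Proof.
elim: c s => [|r1|c1 IH1 c2 IH2|r1 c1 IH1] s //=.
- by rewrite /setr => /negPf->.
- by rewrite negb_or => /andP[/IH1 h1 /IH2 h2]; rewrite h2.
rewrite negb_or => /andP[/negPf nr /IH1 h1]; elim: (s r1) => //= n IH.
by rewrite h1 /setr nr.
Qed.

Lemma mstep_at pre i post s : mstep (pre ++ i :: post) (size pre, s) =
  match i with
  | INC r => ((size pre).+1, setr r (s r).+1 s)
  | DEC r j => if s r == 0 then (j, s) else ((size pre).+1, setr r (s r).-1 s)
  end.
Proof.
by rewrite /mstep size_cat /= addnS ltnS leq_addr nth_cat ltnn subnn.
Qed.

Lemma compile_runs z c pre post s : loops_ok c -> ~~ modifies c z -> s z = 0 ->
  runs (pre ++ compile z (size pre) c ++ post) (size pre, s)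
    (size pre + cmd_size c, den c s).
Proof.
elim: c pre post s => [|r|c1 IH1 c2 IH2|r c1 IH1] pre post s /=.
- by rewrite addn0 => *; apply: runs_refl.
- by move=> _ _ _; apply: runs1; rewrite mstep_at addn1.
- rewrite negb_or => /andP[ok1 ok2] /andP[z1 z2] s0; rewrite -catA.
  apply: runs_trans (IH1 pre _ s ok1 z1 s0) _.
  have := IH2 (pre ++ compile z (size pre) c1) post (den c1 s) ok2 z2.
  by rewrite size_cat size_compile -catA -addnA; apply; rewrite den_unmodified.
rewrite negb_or => /andP[ok1 r1] /andP[zr z1].
set P := pre ++ _; move En: (s r) => n.
elim: n s En => [|n IHn] s En s0.
  by apply: runs1; rewrite /P mstep_at En.
have st1 : mstep P (size pre, s) = ((size pre).+1, setr r n s) by rewrite /P mstep_at En.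
apply: runs_trans (runs1 st1) _; rewrite iterSr En [n.+1.-1]/=.
set s1 := setr r n s; have s10 : s1 z = 0 by rewrite /s1 /setr (negPf zr).
have s1r : s1 r = n by rewrite /s1 /setr eqxx.
(* For the induction hypothesis on the body, the guard joins the code before it and the back jump
   the code after it. *)
have eP : P = rcons pre (DEC r (size pre + (cmd_size c1).+2)) ++
    compile z (size pre).+1 c1 ++ DEC z (size pre) :: post.
  by rewrite /P cat_rcons /= -catA.
have := IH1 (rcons pre (DEC r (size pre + (cmd_size c1).+2))) (DEC z (size pre) :: post)
  s1 ok1 z1 s10.
rewrite size_rcons -eP => run1; apply: runs_trans run1 _.
have dz : den c1 s1 z = 0 by rewrite den_unmodified.
have dr : den c1 s1 r = n by rewrite den_unmodified.
apply: runs_trans _ (IHn _ dr dz); apply: runs1.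
have -> : P = (rcons pre (DEC r (size pre + (cmd_size c1).+2)) ++
    compile z (size pre).+1 c1) ++ DEC z (size pre) :: post by rewrite eP -catA.
have -> : (size pre).+1 + cmd_size c1 = size (rcons pre (DEC r (size pre + (cmd_size c1).+2)) ++
    compile z (size pre).+1 c1) by rewrite size_cat size_rcons size_compile.
by rewrite mstep_at dz.
Qed.

(** The minimum sends every jump past the end of the relocated code to its end exactly, where the
    following code starts. *)
Definition relocate (k m : nat) (i : instr) : instr :=
  match i with INC r => INC r | DEC r j => DEC r (k + minn j m) end.

Lemma relocate_runs P pre post n s :
  let: (pc', s') := iter n (mstep P) s in
  runs (pre ++ map (relocate (size pre) (size P)) P ++ post)
    (size pre + minn s.1 (size P), s.2) (size pre + minn pc' (size P), s').
Proof.
elim: n => [|n]; first by case: s => pc s /=; apply: runs_refl.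
rewrite iterS; case: (iter _ _ _) => pc s' IH.
rewrite /mstep; case: ltnP => [lt_pc|//].
case Es: (match _ with INC _ => _ | DEC _ _ => _ end) => [pc2 s2].
apply: runs_trans IH _; apply: runs1.
rewrite /mstep !size_cat size_map ltn_add2l (minn_idPl (ltnW lt_pc)) (leq_trans lt_pc) ?leq_addr //.
rewrite nth_cat ltnNge leq_addr /= addKn nth_cat size_map lt_pc (nth_map (INC 0)) //.
case: (nth _ P pc) Es => [r|r j] /=.
  by case=> <- <-; rewrite (minn_idPl lt_pc) addnS.
by case: (s' r == 0) => -[<- <-] //; rewrite (minn_idPl lt_pc) addnS.
Qed.

(** The code of a list with head [a] and tail code [n] in MathComp's [pickle]. *)
Definition ccons (a n : nat) : nat := 2 ^ a * n.*2.+1.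

Fixpoint incs (r k : nat) : cmd := if k is k'.+1 then Then (incs r k') (Incr r) else Skip.

Definition spare := 10.

Definition double_reg y := Then (Loop y (incs spare 2)) (Loop spare (Incr y)).
Definition ccons_reg a y :=
  Then (Loop y (incs spare 2)) (Then (Incr spare) (Then (Loop spare (Incr y))
    (Loop a (double_reg y)))).

Lemma setr_same r v w s : setr r v (setr r w s) = setr r v s.
Proof. by apply: functional_extensionality => r'; rewrite /setr; case: eqP. Qed.

Lemma setr_id r s : setr r (s r) s = s.
Proof. by apply: functional_extensionality => r'; rewrite /setr; case: eqP => // ->. Qed.

Lemma setrC r r' v w s : r != r' -> setr r v (setr r' w s) = setr r' w (setr r v s).
Proof.
move=> /eqP rr'; apply: functional_extensionality => r1; rewrite /setr.
by case: eqP => // ->; case: eqP.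
Qed.

Lemma setrE r v s : setr r v s r = v. Proof. by rewrite /setr eqxx. Qed.
Lemma setrN r r' v s : r' != r -> setr r v s r' = s r'.
Proof. by rewrite /setr => /negPf->. Qed.

Lemma den_incs r k s : den (incs r k) s = setr r (s r + k) s.
Proof.
elim: k => [|k IH] /=; first by rewrite addn0 setr_id.
by rewrite IH setr_same setrE addnS.
Qed.

Lemma den_loop_incs r d k s : d != r ->
  den (Loop r (incs d k)) s = setr r 0 (setr d (s d + s r * k) s).
Proof.
move=> dr /=; move En: (s r) => n; elim: n s En => [|n IH] s En.
  by rewrite /= mul0n addn0 setr_id -[in RHS]En setr_id.
rewrite iterSr En den_incs IH; last by rewrite setrN 1?eq_sym // setrE.
rewrite setrE setr_same (setrC _ _ _ dr) setr_same setrN // mulSn addnA.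
by [].
Qed.

Lemma den_double y s : y != spare -> s spare = 0 ->
  den (double_reg y) s = setr y (s y).*2 s.
Proof.
move=> y_sp s0; have sp_y : spare != y by rewrite eq_sym.
change (den (Loop spare (incs y 1)) (den (Loop y (incs spare 2)) s) = setr y (s y).*2 s).
rewrite !den_loop_incs // s0; apply: functional_extensionality => r.
rewrite /setr !eqxx ?(negPf y_sp) ?(negPf sp_y).
case: (r =P spare) => [->|_]; first by rewrite (negPf sp_y).
by case: eqP => // _; rewrite add0n add0n muln1 muln2.
Qed.

Lemma den_ccons a y s : a != y -> a != spare -> y != spare -> s spare = 0 ->
  den (ccons_reg a y) s = setr a 0 (setr y (ccons (s a) (s y)) s).
Proof.
move=> a_y a_sp y_sp s0; have sp_y : spare != y by rewrite eq_sym.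
pose s1 := den (Loop spare (incs y 1)) (den (Incr spare) (den (Loop y (incs spare 2)) s)).
have s1E : s1 = setr y (s y).*2.+1 s.
  rewrite /s1 !den_loop_incs //= s0; apply: functional_extensionality => r.
  rewrite /setr !eqxx ?(negPf y_sp) ?(negPf sp_y).
  case: (r =P spare) => [->|_]; first by rewrite (negPf sp_y).
  by case: eqP => // _; rewrite add0n muln1 muln2.
pose F := fun t => den (double_reg y) (setr a (t a).-1 t).
have FE t : t spare = 0 -> F t = setr a (t a).-1 (setr y (t y).*2 t).
  move=> t0; rewrite /F den_double //; last by rewrite setrN // eq_sym.
  by rewrite setrN 1?eq_sym // setrC // eq_sym.
have iterF n t : t a = n -> t spare = 0 ->
    iter n F t = setr a 0 (setr y (2 ^ n * t y) t).
  elim: n t => [|n IH] t ta t0.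
    by rewrite mul1n setr_id -[in RHS]ta setr_id.
  rewrite iterSr FE // ta IH ?setrE //; last by rewrite !setrN // eq_sym.
  rewrite setrN 1?eq_sym // setrE [setr y _ (setr a _ _)]setrC 1?eq_sym // !setr_same.
  by rewrite expnS -muln2 mulnA mulnAC [2 * _]mulnC.
change (iter (s1 a) F s1 = setr a 0 (setr y (ccons (s a) (s y)) s)).
by rewrite s1E setrN // iterF ?setrE ?setr_same // setrN // eq_sym.
Qed.

Local Arguments den : simpl never.
Local Arguments ccons : simpl never.
Local Arguments incs : simpl never.
Local Arguments modifies : simpl nomatch.
Local Arguments muln : simpl never.

(** * Symbolic execution on explicit stores *)

Definition block (cs : seq cmd) : cmd := foldr Then Skip cs.
Local Arguments block : simpl never.

Lemma den_block c cs s : den (block (c :: cs)) s = den (block cs) (den c s).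
Proof. by []. Qed.

Lemma den_nil s : den (block [::]) s = s. Proof. by []. Qed.

(** With a store given as a list, assignments become [set_nth], which computes. *)
Definition st (v : seq nat) : nat -> nat := fun r => nth 0 v r.

Lemma setr_st r x v : setr r x (st v) = st (set_nth 0 v r x).
Proof. by apply: functional_extensionality => r'; rewrite /st nth_set_nth. Qed.

Lemma incs_st r k v : den (incs r k) (st v) = st (set_nth 0 v r (nth 0 v r + k)).
Proof. by rewrite den_incs setr_st. Qed.

Lemma loop_incs_st r d k v : d != r -> den (Loop r (incs d k)) (st v) =
  st (set_nth 0 (set_nth 0 v d (nth 0 v d + nth 0 v r * k)) r 0).
Proof. by move=> dr; rewrite den_loop_incs // !setr_st. Qed.

Lemma ccons_st a y v : a != y -> a != spare -> y != spare -> nth 0 v spare = 0 ->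
  den (ccons_reg a y) (st v) =
  st (set_nth 0 (set_nth 0 v y (ccons (nth 0 v a) (nth 0 v y))) a 0).
Proof. by move=> ay a_sp y_sp v0; rewrite den_ccons // !setr_st. Qed.

(** [pickle] codes a pair as the two-element list of the codes of its components. *)
Definition pair_code (a b : nat) : nat := ccons a (ccons b 0).

Definition trans_code (q c q' : nat) : nat := pair_code (pair_code q c) q'.

(* Registers: 1 is the loop counter, 2 the list built so far, 3 the current
   index i, and the others are scratch. *)
Definition push_trans (c : nat) : cmd :=
  block [:: ccons_reg 6 7; incs 8 c; ccons_reg 8 9; ccons_reg 5 9;
            ccons_reg 9 7; ccons_reg 7 2].

(** Node [load i] is state 4i of the generator, whence the factor 4. The first loop consumes the
    index, so register 4 saves it. *)
Definition spread_index : cmd :=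
  block [:: Loop 3 (block [:: incs 4 1; incs 5 4; incs 6 4]); Loop 4 (incs 3 1)].

(** An edge on v gives two transitions; the acknowledgement is pushed first because the list grows
    at its head. *)
Definition push_load_edge (cA cV : nat) : cmd :=
  block [:: spread_index; incs 5 1; push_trans cA;
            spread_index; incs 5 4; incs 6 1; push_trans cV; incs 3 1].

(** The input serves twice, as the number of load edges and as the code of the remaining generator
    transitions: this is the self reference. [cA] and [cV] code the two actions, [cP] the other
    peers and [cM] the message set. *)
Definition encode_cmd (cA cV cP cM : nat) : cmd :=
  block [:: Loop 0 (block [:: incs 1 1; incs 2 1]); Loop 1 (push_load_edge cA cV);
            ccons_reg 2 7; Loop 3 (incs 5 4); ccons_reg 5 7;
            incs 8 cP; ccons_reg 7 8; ccons_reg 8 9;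
            incs 6 cM; ccons_reg 6 9; Loop 9 (incs 0 1)].

Fixpoint load_code (cA cV x y : nat) : nat :=
  if x is i.+1 then
    ccons (trans_code (4 * i + 4) cV (4 * i + 1))
      (ccons (trans_code (4 * i + 1) cA (4 * i)) (load_code cA cV i y))
  else y.

Lemma push_trans_st c n y i a b :
  den (push_trans c) (st [:: 0; n; y; i; 0; a; b; 0; 0; 0; 0]) =
  st [:: 0; n; ccons (trans_code a c b) y; i; 0; 0; 0; 0; 0; 0; 0].
Proof.
rewrite /push_trans !den_block den_nil.
rewrite ccons_st //= incs_st /= add0n.
by rewrite !ccons_st.
Qed.

Lemma loop_step r c n s : s r = n.+1 ->
  ~~ modifies c r -> den (Loop r c) s = den (Loop r c) (den c (setr r n s)).
Proof.
move=> sr nr; rewrite /den -/den sr iterSr sr [n.+1.-1]/=.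
by rewrite (den_unmodified _ nr) setrE.
Qed.

Lemma loop_end r c s : s r = 0 -> den (Loop r c) s = s.
Proof. by rewrite /den -/den => ->. Qed.

Lemma spread_index_st n y i :
  den spread_index (st [:: 0; n; y; i; 0; 0; 0; 0; 0; 0; 0]) =
  st [:: 0; n; y; i; 0; 4 * i; 4 * i; 0; 0; 0; 0].
Proof.
rewrite /spread_index !den_block den_nil.
set c := block _.
have -> j t a b : den (Loop 3 c) (st [:: 0; n; y; j; t; a; b; 0; 0; 0; 0]) =
    st [:: 0; n; y; 0; t + j; a + 4 * j; b + 4 * j; 0; 0; 0; 0].
  elim: j t a b => [|j IH] t a b; first by rewrite loop_end // !addn0.
  rewrite (@loop_step _ _ j) // setr_st /= /c !den_block den_nil !incs_st /= IH.
  by rewrite addn1 addSnnS !mulnS !addnA.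
by rewrite loop_incs_st //= !add0n muln1.
Qed.

Lemma modifies_incs r k r' : modifies (incs r k) r' = (r' == r) && (0 < k).
Proof. by elim: k => [|k IH] /=; rewrite ?andbF // IH; case: (r' == r); case: k {IH}. Qed.

Lemma loops_ok_incs r k : loops_ok (incs r k).
Proof. by elim: k => //= k ->. Qed.

Lemma push_load_edge_counter cA cV : ~~ modifies (push_load_edge cA cV) 1.
Proof. by rewrite /= !modifies_incs. Qed.

Lemma encode_cmd_ok cA cV cP cM :
  loops_ok (encode_cmd cA cV cP cM) && ~~ modifies (encode_cmd cA cV cP cM) 11.
Proof. by rewrite /= !modifies_incs !loops_ok_incs. Qed.

Lemma load_codes_st cA cV n y i y0 : y = load_code cA cV i y0 ->
  den (Loop 1 (push_load_edge cA cV)) (st [:: 0; n; y; i; 0; 0; 0; 0; 0; 0; 0]) =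
  st [:: 0; 0; load_code cA cV (i + n) y0; i + n; 0; 0; 0; 0; 0; 0; 0].
Proof.
elim: n i y => [|n IH] i y ->; first by rewrite loop_end // addn0.
rewrite (@loop_step _ _ n) //; last first.
  exact: push_load_edge_counter.
rewrite setr_st /=.
rewrite {2}/push_load_edge den_block spread_index_st den_block incs_st /=.
rewrite den_block push_trans_st den_block spread_index_st den_block incs_st /=.
rewrite den_block incs_st /= den_block push_trans_st den_block incs_st /= den_nil.
by rewrite [i + 1]addn1 (IH i.+1) ?addSnnS.
Qed.

Lemma encode_cmd_st cA cV cP cM x :
  den (encode_cmd cA cV cP cM) (fun r => if r == 0 then x else 0) =
  (fun r => if r == 0 then
     pair_code cM (ccons (pair_code (4 * x) (load_code cA cV x x)) cP) else 0).
Proof.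
have stE v : (fun r => if r == 0 then v else 0) = st [:: v; 0; 0; 0; 0; 0; 0; 0; 0; 0; 0].
  by apply: functional_extensionality => r; do 11![case: r => //= r]; rewrite /st /= nth_nil.
rewrite !stE /encode_cmd !den_block den_nil.
set c := block _.
have -> j t a : den (Loop 0 c) (st [:: j; t; a; 0; 0; 0; 0; 0; 0; 0; 0]) =
    st [:: 0; t + j; a + j; 0; 0; 0; 0; 0; 0; 0; 0].
  elim: j t a => [|j IH] t a; first by rewrite loop_end // !addn0.
  rewrite (@loop_step _ _ j) // setr_st /= /c !den_block den_nil !incs_st /= IH.
  by rewrite !addn1 !addSnnS.
rewrite !add0n (load_codes_st (i := 0) _ (erefl x)) add0n.
rewrite ccons_st //= loop_incs_st //= add0n ccons_st //= incs_st /= add0n !ccons_st //=.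
rewrite incs_st /= add0n ccons_st //= loop_incs_st //= add0n muln1.
by rewrite mulnC.
Qed.

(** * Self-application *)

Definition reg_of (i : instr) : nat := match i with INC r => r | DEC r _ => r end.

Lemma registers_bounded P : exists K, forall K', K <= K' -> all (fun i => reg_of i < K') P.
Proof.
elim: P => [|i P [K HK]]; first by exists 0.
exists (maxn (reg_of i).+1 K) => K'; rewrite geq_max => /andP[/= -> /HK ->].
by [].
Qed.

Lemma jumps_bounded K P : all (fun i => reg_of i < K) P -> exists N, program_below K N P.
Proof.
move=> PK; suff [N HN] : exists N, forall N', N <= N' -> all (instr_below K N') P.
  by exists (maxn (size P).+1 N); rewrite /program_below leq_maxl HN // leq_maxr.
elim: P PK => [|i P IH] /=; first by exists 0.
case/andP=> iK /IH[N HN]; case: i iK => [r|r j] /= iK.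
  by exists N => N' /HN ->; rewrite iK.
exists (maxn j.+1 N) => N'; rewrite geq_max => /andP[-> /HN ->].
by rewrite iK.
Qed.

Lemma compile_registers K z o c : (forall r, modifies c r -> r < K) -> z < K ->
  all (fun i => reg_of i < K) (compile z o c).
Proof.
move=> + zK; elim: c o => [|r|c1 IH1 c2 IH2|r c1 IH1] o //= cK.
- by rewrite cK.
- by rewrite all_cat IH1 ?IH2 // => r r_c; apply: cK; rewrite r_c ?orbT.
- by rewrite all_cat cK ?eqxx //= zK IH1 // => r' r_c; apply: cK; rewrite r_c orbT.
Qed.

Lemma encode_cmd_modifies cA cV cP cM r : modifies (encode_cmd cA cV cP cM) r -> r < 11.
Proof.
by do 11![case: r => // r]; rewrite /= !modifies_incs.
Qed.

(** * Codes of transitions and systems *)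

Lemma pickle_consE (A : countType) (a : A) s : pickle (a :: s) = ccons (pickle a) (pickle s).
Proof. by []. Qed.

Lemma pickle_transE q a q' : pickle (q, a, q') = trans_code q (pickle (a : action)) q'.
Proof. by []. Qed.

Definition transitions (G : seq edge) : seq (nat * action * nat) :=
  flatten (map generator_edge G).

Lemma generator_code G x :
  pickle (transitions (load_edges x ++ G)) =
  load_code (pickle (Recv ackm)) (pickle (Send (vmsg (regl 0)))) x (pickle (transitions G)).
Proof.
elim: x => // x IH; pose a1 := Send (vmsg (regl 0)); pose a2 := Recv ackm.
have -> : transitions (load_edges x.+1 ++ G) =
    (4 * x + 4, a1, 4 * x + 1) :: (4 * x + 1, a2, 4 * x) :: transitions (load_edges x ++ G).
  have [e4 e0] : (load x.+1).*2 = 4 * x + 4 /\ (load x).*2 = 4 * x by rewrite /load; lia.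
  by rewrite -e4 -e0 addn1.
by rewrite !pickle_consE !pickle_transE IH.
Qed.

Lemma pickle_systemE (M : msgset) q tr (S : system) :
  pickle (M, (q, tr) :: S) = pair_code (pickle M) (ccons (pair_code q (pickle tr)) (pickle S)).
Proof. by []. Qed.

Lemma pickle_queue_system A G x :
  pickle (queue_msgset A, queue_system A (load x) (load_edges x ++ G)) =
  pair_code (pickle (queue_msgset A))
    (ccons (pair_code (4 * x) (load_code (pickle (Recv ackm))
              (pickle (Send (vmsg (regl 0)))) x (pickle (transitions G))))
       (pickle [:: checker A; relay A])).
Proof.
rewrite -generator_code; have <- : (load x).*2 = 4 * x by rewrite /load; lia.
exact: pickle_systemE.
Qed.

(** The last instruction has its own address as jump target: it loops forever on answer 0 and runs
    off the end on any other. *)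
Definition reduction (P : program) (cA cV cP cM : nat) : program :=
  let c := encode_cmd cA cV cP cM in
  compile 11 0 c ++ map (relocate (cmd_size c) (size P)) P
    ++ [:: DEC 0 (cmd_size c + size P)].

(** Configurations past the end are fixed by [mstep] as well, so a run that gets stuck inside the
    program was never past its end. *)
Lemma halts_onP P n x : runs P (0, fun r => if r == 0 then x else 0) n ->
  (size P <= n.1 -> halts_on P x) /\ (n.1 < size P -> mstep P n = n -> ~ halts_on P x).
Proof.
case=> k <-; split=> [le_size|]; first by exists k.
set s := iter k _ _ => lt_s fix_s [m le_m].
have fixE s' j : mstep P s' = s' -> iter j (mstep P) s' = s'.
  by move=> fs; elim: j => //= j ->.
have [le_km|/ltnW le_mk] := leqP k m.
  by move: le_m; rewrite -(subnK le_km) iterD fixE // leqNgt lt_s.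
move: lt_s; rewrite /s -(subnK le_mk) iterD fixE ?ltnNge ?le_m //.
by case: (iter m _ _) le_m => pc rho /= le_pc; rewrite /mstep ltnNge le_pc.
Qed.

Lemma reduction_registers K P cA cV cP cM : 12 <= K ->
  all (fun i => reg_of i < K) P -> all (fun i => reg_of i < K) (reduction P cA cV cP cM).
Proof.
move=> le_K PK; rewrite /reduction.
have : all (fun i => reg_of i < K) (compile 11 0 (encode_cmd cA cV cP cM)).
  apply: compile_registers => // r /encode_cmd_modifies/ltnW lt_r; exact: leq_trans le_K.
move: (compile _ _ _) (cmd_size _) => pre k preK; rewrite !all_cat preK all_map /= (leq_trans _ le_K) //= andbT.
by move: PK; apply: sub_all => -[].
Qed.

Lemma reduction_halts P cA cV cP cM x m :
  let y := pair_code cM (ccons (pair_code (4 * x) (load_code cA cV x x)) cP) in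
  halts_with P y m -> m = 0 <-> ~ halts_on (reduction P cA cV cP cM) x.
Proof.
move=> y [n]; set c := encode_cmd cA cV cP cM; set E := reduction P cA cV cP cM.
case Ey: (iter _ _ _) => [pc regs] [le_pc em].
pose L := cmd_size c + size P.
have [pre epre size_pre] : exists2 pre, compile 11 0 c = pre & size pre = cmd_size c.
  by exists (compile 11 0 c); last exact: size_compile.
have eE : E = pre ++ map (relocate (size pre) (size P)) P ++ [:: DEC 0 L].
  by rewrite size_pre -epre.
have sizeE : size E = L.+1 by rewrite eE !size_cat size_map size_pre /= addnA addn1.
have run : runs E (0, fun r => if r == 0 then x else 0) (L, regs).
  have /andP[ok z] := encode_cmd_ok cA cV cP cM.
  have := compile_runs (s := fun r => if r == 0 then x else 0) [::]
    (map (relocate (size pre) (size P)) P ++ [:: DEC 0 L]) ok z erefl.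
  rewrite encode_cmd_st -/c -/y epre cat0s -eE add0n => run1; apply: runs_trans run1 _.
  have := relocate_runs P pre [:: DEC 0 L] n (0, fun r => if r == 0 then y else 0).
  by rewrite Ey -eE size_pre min0n addn0 (minn_idPr le_pc).
have stepE : mstep E (L, regs) = if m == 0 then (L, regs) else (L.+1, setr 0 m.-1 regs).
  have {1}-> : L = size (pre ++ map (relocate (size pre) (size P)) P).
    by rewrite size_cat size_map size_pre.
  by rewrite eE catA mstep_at em size_cat size_map size_pre.
split=> [m0|not_halts].
  by apply: (halts_onP run).2; rewrite ?sizeE // stepE m0.
case: (m =P 0) stepE => // _ stepE; case: not_halts.
by apply: (halts_onP (runs_trans run (runs1 stepE))).1; rewrite sizeE.
Qed.

Lemma halts_on_queue_system P K N x (A := K + 3)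
    (S := queue_system A (load x) (counter_graph P K N x)) :
  0 < K -> program_below K N P ->
  [/\ wf_input (queue_msgset A, S),
      halts_on P x -> ~ lang_synchronizable (queue_msgset A) S
    & ~ halts_on P x -> synchronizable (queue_msgset A) S].
Proof.
move=> K_gt0 belowP; have A_gt0 : 0 < A by rewrite /A addn3.
have lettersG := letter_graph (x := x) K_gt0 belowP.
have ahead := graph_write_ahead (x := x) K_gt0 belowP.
split; first exact: queue_wf.
- move=> /(graph_complete K_gt0 belowP)[q [u [v [w [path wu wv]]]]].
  exact: accepted_not_lang_synchronizable path wu wv.
- move=> not_halts; apply: not_accepted_synchronizable => // q u v w path wu wv.
  by apply: not_halts; apply: graph_sound path wu wv.
Qed.

(** On the systems of counter graphs both synchronizability properties are equivalent to
    non-halting, so one diagonal argument serves every [Q] between them. *)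
Lemma undecidable_between (Q : msgset * system -> Prop) :
  (forall M S, synchronizable M S -> Q (M, S)) ->
  (forall M S, Q (M, S) -> lang_synchronizable M S) ->
  undecidable wf_input Q.
Proof.
move=> syncQ Qlang [P decP].
(* The encoder uses registers 0 to 10 and the constantly zero register 11, whence the bound 12. *)
have [K0 regsP] := registers_bounded P; pose K := maxn 12 K0; pose A := K + 3.
have K_gt0 : 0 < K by rewrite leq_max.
pose E := reduction P (pickle (Recv ackm)) (pickle (Send (vmsg (regl 0))))
  (pickle [:: checker A; relay A]) (pickle (queue_msgset A)).
have [N belowE] : exists N, program_below K N E.
  by apply/jumps_bounded/reduction_registers; [apply: leq_maxl | apply/regsP/leq_maxr].
(* The base edges do not depend on the input, so there is no circularity in taking their code as
   [x]. *)
pose x := pickle (transitions (base_edges E K N)).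
have [wf haltsN haltsS] := halts_on_queue_system x K_gt0 belowE.
set S := queue_system _ _ _ in wf haltsN haltsS.
have codeS := pickle_queue_system A (base_edges E K N) x.
rewrite -/x -/(counter_graph E K N x) -/S in codeS.
have [decQ decN] := decP (queue_msgset A, S) wf.
(* If [E] halted on [x], then [Q] would fail, [P] would answer 0 and [E] would loop. Hence [Q] holds
   and [P] answers 1, which makes [E] halt after all. *)
have not_halts : ~ halts_on E x.
  move=> hx; have : ~ Q (queue_msgset A, S) by move=> /Qlang; apply: haltsN.
  by move/decN; rewrite codeS => /reduction_halts[/(_ erefl) nh _]; apply: nh.
have := decQ (syncQ _ _ (haltsS not_halts)).
by rewrite codeS => /reduction_halts[_ /(_ not_halts)].
Qed.

Theorem theorem3p8 :
  undecidable wf_input (fun x : msgset * system => synchronizable x.1 x.2) /\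
  undecidable wf_input (fun x : msgset * system => lang_synchronizable x.1 x.2).
Proof.
have lang M S : synchronizable M S -> lang_synchronizable M S.
  by move=> sync w; apply: (sync (inl w)).
by split; apply: undecidable_between => M S //=; apply: lang.
Qed.
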